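(* Let $q$ be a prime power and $m,\ell$ positive integers such that $\ell<\frac m2$ and $m_\ell=\frac{m}{(m,\ell)}$ is even. Put $n=\frac{q^m-1}{q^{(m,\ell)}+1}$, $N=q^m-1$, $\delta=(m,\ell)$ and $\varepsilon_\ell=(-1)^{\frac12 m_\ell}$. Then $\mathcal{C}_{\ell,1}$ is an $[N,2m,d]_q$-code with $d=q^{m-1}(q-1)-d'$, where $$d'=\begin{cases} q^{\frac m2+\delta-1} & \text{if }\frac12 m_\ell\text{ is even},\\ (q-1)q^{\frac m2+\delta-1} & \text{if }\frac12 m_\ell\text{ is odd},\end{cases}$$ and $\mathcal{C}_{\ell,2}$ is an $[N,2m+1,d-1]_q$-code. The weight distributions are as follows (frequencies attached to coinciding weights are to be added). (1) $\mathcal{C}_{\ell,1}$: weight $0$ with frequency $1$; weight $q^m-q^{m-1}$ with frequency $n(q^m-q^{m-2\delta})+q^m-1$; weight $q^m-q^{m-1}-\varepsilon_\ell(q-1)q^{\frac m2-1}$ with frequency $nq^{\delta}(q^{m-1}+\varepsilon_\ell(q-1)q^{\frac m2-1})$; weight $q^m-q^{m-1}+\varepsilon_\ell(q-1)q^{\frac m2+\delta-1}$ with frequency $n(q^{m-1-2\delta}-\varepsilon_\ell(q-1)q^{\frac m2-\delta-1})$; weight $q^m-q^{m-1}+\varepsilon_\ell q^{\frac m2-1}$ with frequency $nq^{\delta}(q^{m-1}-\varepsilon_\ell q^{\frac m2-1})(q-1)$; weight $q^m-q^{m-1}-\varepsilon_\ell q^{\frac m2+\delta-1}$ with frequency $n(q^{m-1-2\delta}+\varepsilon_\ell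 q^{\frac m2-\delta-1})(q-1)$. (2) $\mathcal{C}_{\ell,2}$: all the weights with the frequencies listed in (1), and in addition: weight $q^m-1$ with frequency $q-1$; weight $q^m-q^{m-1}-1$ with frequency $n(q^m-q^{m-2\delta})(q-1)+(q^m-1)(q-1)$; weight $q^m-q^{m-1}-\varepsilon_\ell(q-1)q^{\frac m2-1}-1$ with frequency $nq^{\delta}(q^{m-1}-\varepsilon_\ell q^{\frac m2-1})(q-1)$; weight $q^m-q^{m-1}+\varepsilon_\ell(q-1)q^{\frac m2+\delta-1}-1$ with frequency $n(q^{m-1-2\delta}+\varepsilon_\ell q^{\frac m2-\delta-1})(q-1)$; weight $q^m-q^{m-1}+\varepsilon_\ell q^{\frac m2-1}-1$ with frequency $nq^{\delta}(q^m-q^{m-1}+\varepsilon_\ell q^{\frac m2-1})(q-1)$; weight $q^m-q^{m-1}-\varepsilon_\ell q^{\frac m2+\delta-1}-1$ with frequency $n(q^{m-2\delta}-q^{m-1-2\delta}-\varepsilon_\ell q^{\frac m2-\delta-1})(q-1)$.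
   Context: $(m,\ell)$ denotes the greatest common divisor and $\mathrm{Tr}_{q^m/q}$ the trace from $\mathbb{F}_{q^m}$ to $\mathbb{F}_q$. The cyclic codes (coordinates indexed by $\mathbb{F}_{q^m}^*$, ordered by powers of a primitive element) are $\mathcal{C}_{\ell,1}=\{(\mathrm{Tr}_{q^m/q}(\gamma x^{q^\ell+1}+\beta x))_{x\in\mathbb{F}_{q^m}^*}:\gamma,\beta\in\mathbb{F}_{q^m}\}$ and $\mathcal{C}_{\ell,2}=\{(\mathrm{Tr}_{q^m/q}(\gamma x^{q^\ell+1}+\beta x)+b)_{x\in\mathbb{F}_{q^m}^*}:\gamma,\beta\in\mathbb{F}_{q^m},\ b\in\mathbb{F}_q\}$. An $[N,k,d]_q$-code is a $k$-dimensional linear code in $\mathbb{F}_q^N$ with minimum Hamming distance $d$. The weight of a codeword is its number of nonzero coordinates; the frequency of a weight is the number of codewords with that weight. *)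

(* Defs.v *)
From HB Require Import structures.
From mathcomp Require Import all_boot all_order all_fingroup all_algebra.
From mathcomp Require Import all_solvable all_field.

Set Implicit Arguments.
Unset Strict Implicit.
Unset Printing Implicit Defensive.

Import Order.TTheory GRing.Theory Num.Theory.
Local Open Scope ring_scope.

Section Codes.

Variables (F : finFieldType) (N : nat).
Implicit Types (C : {set 'rV[F]_N}) (c : 'rV[F]_N).

Definition hamming_weight c : nat := #|[set j | c 0 j != 0]|.

Definition hamming_dist c c' : nat := #|[set j | c 0 j != c' 0 j]|.

Definition min_distance C (d : nat) : Prop :=
  (exists c c', [/\ c \in C, c' \in C, c != c' & hamming_dist c c' = d]) /\
  {in C &, forall c c', c != c' -> (d <= hamming_dist c c')%N}.

(* C is an [N, k, d]-code over F. *)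
Definition is_code C (k d : nat) : Prop :=
  (exists2 V : {vspace 'rV[F]_N}, C =i V & \dim V = k) /\ min_distance C d.

(* t lists (weight, frequency) pairs; the frequencies attached to equal weights
   are added, and a weight not listed in t has frequency 0. *)
Definition has_weight_distribution C (t : seq (int * int)) : Prop :=
  forall w : int,
    #|[set c in C | (hamming_weight c)%:Z == w]|%:Z
      = \sum_(p <- t | p.1 == w) p.2.

End Codes.

Section CyclicCodes.

Variables (F : finFieldType) (L : fieldExtType F).

(* galTrace takes its values in L; Tr is the same trace with its values in the
   base field F, see TrE. *)
Definition Tr (x : L) : F :=
  odflt 0 [pick a : F | a%:A == galTrace 1 {:finvect_type L} x].

Lemma galois_finvect : galois 1 {:finvect_type L}.
Proof.
exact: (@finField_galois F (finvect_type L) 1%AS {:finvect_type L}%AS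
                         (sub1v _)).
Qed.

Lemma TrE x : (Tr x)%:A = galTrace 1 {:finvect_type L} x.
Proof.
rewrite /Tr; case: pickP => [a /eqP // | no_a].
have : galTrace 1 {:finvect_type L} x \in 1%VS.
  by apply: mem_galTrace; [exact: galois_finvect | exact: memvf].
by case/vlineP => a Da; have := no_a a; rewrite Da eqxx.
Qed.

Lemma galTrace_Frobenius (x : L) :
  galTrace 1 {:finvect_type L} x = \sum_(i < \dim {:L}) x ^+ (#|F| ^ i).
Proof.
have [s /eqP genG sE] :=
  @finField_galois_generator F (finvect_type L) 1%AS {:finvect_type L}%AS
                             (sub1v _).
have sX i y : (s ^+ i)%g y = y ^+ (#|F| ^ i).
  elim: i y => [|i IHi] y; first by rewrite gal_id expr1.
  rewrite expgS galM ?memvf // IHi sE ?memvf // dimv1 expn1 -exprM.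
  by rewrite expnS.
have os : #[s]%g = \dim {:L}.
  by rewrite orderE -genG -(galois_dim galois_finvect) dimv1 divn1.
rewrite /galTrace genG -os.
have -> : <[s]>%g = [set (s ^+ (i : 'I_#[s]%g))%g | i in 'I_#[s]%g].
  apply/setP=> y; apply/idP/imsetP => [/cyclePmin[i lt_i ->]|[i _ ->]].
    by exists (Ordinal lt_i).
  exact: mem_cycle.
rewrite big_imset /= => [|i j _ _ /eqP].
  by apply: eq_bigr => i _; rewrite sX.
by rewrite eq_expg_mod_order !modn_small // => /eqP/val_inj.
Qed.

(* For a primitive N-th root of unity a with N = #|L| - 1, the points a ^+ j,
   j < N, are the nonzero elements of L. *)
Definition codeword (l N : nat) (a g b : L) : 'rV[F]_N :=
  \row_(j < N) Tr (g * (a ^+ j) ^+ (#|F| ^ l + 1) + b * a ^+ j).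

Definition code1 (l N : nat) (a : L) : {set 'rV[F]_N} :=
  [set codeword l N a g b | g : finvect_type L, b : finvect_type L].

Definition code2 (l N : nat) (a : L) : {set 'rV[F]_N} :=
  [set codeword l N a p.1 p.2 + const_mx b
    | p : finvect_type L * finvect_type L, b : F].

End CyclicCodes.

(* Main.v *)
Require Import Defs.
From HB Require Import structures.
From mathcomp Require Import all_boot all_order all_fingroup all_algebra.
From mathcomp Require Import all_solvable all_field.
From mathcomp Require Import zify ring.

Set Implicit Arguments.
Unset Strict Implicit.
Unset Printing Implicit Defensive.

Import Order.TTheory GRing.Theory Num.Theory.
Local Open Scope ring_scope.

(** Let [K] be the extension of degree [m] of [F], let [q = #|F|], and write
    [Q_g (x) = Tr (g * x ^+ (q ^ l + 1))].  The coordinates of a codeword are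
    the values of [Q_g (x) + Tr (b * x) + c] at the nonzero [x] (with [c = 0]
    for the first code), so its weight is [q ^ m] minus the number of zeros of
    this function on [K], minus 1 more if [c != 0], because then [x = 0] is a
    nonzero value that is not a coordinate.  The whole theorem is therefore a
    count of zeros.  [Q_g] is a quadratic form over [F], and elementary
    counting suffices, in every characteristic.

    - The radical.  The polarisation of [Q_g] is [Tr (polar g h * x)].  A
      nonzero [h] is in the kernel of [polar g] iff [u = g * h ^+ (q ^ l + 1)]
      satisfies [u ^+ (q ^ l) = - u].  The ratio of two such [h] is a root of
      unity of order dividing [q ^ (2 * l) - 1], and [gcd (2 * l, m) = 2 * delta]
      since [m / delta] is even; so the radical has 1 or [q ^ (2 * delta)]
      elements ([card_radical]).

    - The level sets.  Every [c != 0] of [F] is a [(q ^ l + 1)]-st power in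
      [K], so all nonzero levels of [Q_g] have the same size
      ([card_level_scale]).  Let [S] be the size of the zero level minus the
      size of a nonzero level.  Counting the pairs with [Q_g (x) = Q_g (y)]
      gives [S ^+ 2 = q ^ m * #|radical g|] ([sqr_level_diff]).  The roots of
      unity of order dividing [q ^ delta + 1] act freely on the nonzero levels
      ([dvdn_card_level]), so [S] is 1 modulo [q ^ delta + 1], and this
      determines its sign ([qform_level_diff]).

    - The number of [g] of each kind.  Counting the pairs with [Q_g (x) = 0]
      shows that the values of [S] for [g != 0] have sum 0; as they have only
      two values, this gives the number of forms with trivial radical and with
      nontrivial radical ([card_nonsingular], [card_singular]).

    - The linear term.  If [b] is in the image of [polar g], completing the
      square turns the zeros into a level set of [Q_g].  Otherwise [b] is not
      orthogonal to the radical, and [Q_g (x) + Tr (b * x) + c] takes all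
      values equally often ([sum_zeros]).

    The result is kept as an identity between the sum of [G (weight)] over all
    parameters [(g, b, c)] and the sum of [frequency * G (weight)] over a table,
    for every function [G].  Indicator functions [G] then give everything: only
    the zero parameters have weight 0, so that the encoder is injective, which
    yields the dimensions and turns frequencies of parameters into frequencies
    of codewords; the minimum distance is the least nonzero weight of the
    table ([code_params], [code_weight_distribution]). *)

(** * The trace form of a finite field extension *)

Section Trace.

Variables (F : finFieldType) (L : fieldExtType F).
Local Notation K := (finvect_type L).
(* Unless the extension is given, the trace of [x : K] would be that of the
   extension type K and not that of L. *)
Local Notation Tr := (@Tr F L).
Local Notation q := #|F|.

Lemma card_ext : #|K| = (q ^ \dim {:L})%N.
Proof. by rewrite -(@card_vspace F K _ {:L}%VS) card_vspacef. Qed.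

Lemma expf_cardX (c : F) i : c ^+ (q ^ i) = c.
Proof.
elim: i => [|i IHi]; first by rewrite expr1.
by rewrite expnS exprM expf_card.
Qed.

(** [q] is a power of the characteristic. *)
Lemma frobD (x y : K) i : (x + y) ^+ (q ^ i) = x ^+ (q ^ i) + y ^+ (q ^ i).
Proof.
have [p p_pr pcharF] := finPcharP F.
have pcharK : p \in [pchar K] by rewrite (fmorph_pchar (in_alg K)).
rewrite exprDn_pchar // (eq_pnat _ (pcharf_eq pcharK)).
rewrite pnatX; apply/orP; left.
have := fin_ring_pchar_abelem pcharF => /and3P[+ _ _].
by rewrite /pgroup cardsT.
Qed.

Lemma Tr_sum_frob (x : K) :
  (Tr x)%:A = \sum_(i < \dim {:L}) x ^+ (q ^ i) :> K.
Proof. exact: etrans (@TrE F L x) (@galTrace_Frobenius F L x). Qed.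

Lemma alg_inj : injective (fun c : F => c%:A : K).
Proof. exact: (fmorph_inj (in_alg K)). Qed.

Lemma TrD (x y : K) : Tr (x + y) = Tr x + Tr y.
Proof.
apply: alg_inj; rewrite scalerDl !Tr_sum_frob -big_split.
by apply: eq_bigr => i _; rewrite frobD.
Qed.

Lemma TrZ c (x : K) : Tr (c *: x) = c * Tr x.
Proof.
apply: alg_inj; rewrite -scalerA !Tr_sum_frob scaler_sumr.
by apply: eq_bigr => i _; rewrite exprZn expf_cardX.
Qed.

Lemma Tr0 : Tr (0 : K) = 0.
Proof. by have := TrZ 0 0; rewrite scale0r mul0r. Qed.

Lemma frob_id (x : K) : x ^+ (q ^ \dim {:L}) = x.
Proof. by rewrite -card_ext expf_card. Qed.

Lemma Tr_frob (x : K) i : Tr (x ^+ (q ^ i)) = Tr x.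
Proof.
elim: i x => [|i IHi] x; first by rewrite expr1.
rewrite expnSr exprM -[RHS]IHi; move: (x ^+ _) => {IHi} y.
apply: alg_inj; rewrite !Tr_sum_frob.
have := frob_id y; case: (\dim _) => [|d] yE; first by rewrite !big_ord0.
rewrite big_ord_recr big_ord_recl /= addrC.
congr (_ + _); first by rewrite -exprM -expnS yE expr1.
by apply: eq_bigr => j _; rewrite -exprM -expnS.
Qed.

Lemma dim_ext_gt0 : (0 < \dim {:L})%N.
Proof. exact: (adim_gt0 {:L}%AS). Qed.

(** The trace is the value of a polynomial of degree [q ^ (m - 1)], which cannot
    vanish on all [q ^ m] points. *)
Lemma Tr_neq0 : exists x : K, Tr x != 0.
Proof.
apply/existsP; rewrite -negb_forall; apply/negP => /forallP Tr_eq0.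
have q_gt1 : (1 < q)%N := finNzRing_gt1 F.
have d_gt0 := dim_ext_gt0.
pose P : {poly K} := \sum_(i < \dim {:L}) 'X^(q ^ i).
have sP : size P = (q ^ (\dim {:L}).-1).+1.
  rewrite /P; case: (\dim _) d_gt0 => // d _; rewrite big_ord_recr /=.
  rewrite addrC size_polyDl size_polyXn // ltnS.
  apply: leq_trans (size_sum _ _ _) _; apply/bigmax_leqP => i _.
  by rewrite size_polyXn ltn_exp2l.
have P_neq0 : P != 0 by rewrite -size_poly_eq0 sP.
have rootP : all (root P) (enum K).
  apply/allP => x _; rewrite rootE horner_sum.
  under eq_bigr do rewrite hornerXn.
  by rewrite -Tr_sum_frob (eqP (Tr_eq0 x)) scale0r.
have := max_poly_roots P_neq0 rootP (enum_uniq K).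
by rewrite -cardE card_ext sP ltnS leqNgt ltn_exp2l // prednK // leqnn.
Qed.

End Trace.

(** * Counting by translations *)

Lemma sum_card_fibers (T S : finType) (f : T -> S) :
  (\sum_c #|[set x | f x == c]| = #|T|)%N.
Proof.
rewrite -sum1_card (partition_big f predT) //=.
by apply: eq_bigr => c _; rewrite -sum1dep_card.
Qed.

(** Translations of [A] that shift [f] by arbitrary constants permute the fibres
    transitively, so the fibres have equal sizes. *)
Lemma card_translation_fibers_in (V S : finZmodType) (A : {set V})
    (f : V -> S) :
    (forall c, exists h, (forall x, (x + h \in A) = (x \in A)) /\
                         {in A, forall x, f (x + h) = f x + c}) ->
  forall c, (#|S| * #|[set x in A | f x == c]| = #|A|)%N.
Proof.
move=> f_tr c; have -> : #|A| = (\sum_d #|[set x in A | f x == d]|)%N.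
  rewrite -sum1_card (partition_big f predT) //=.
  by apply: eq_bigr => d _; rewrite -sum1dep_card.
rewrite -sum_nat_const; apply: eq_bigr => d _; have [h [hA fh]] := f_tr (c - d).
rewrite -!sum1dep_card (reindex_inj (addIr h)) /=; apply: eq_bigl => x.
rewrite hA; have [xA|//] := boolP (x \in A).
by rewrite fh // addrA subr_eq [f x + c]addrC (inj_eq (addrI c)).
Qed.

Lemma card_translation_fibers (V S : finZmodType) (f : V -> S) :
    (forall c, exists h, forall x, f (x + h) = f x + c) ->
  forall c, (#|S| * #|[set x | f x == c]| = #|V|)%N.
Proof.
move=> f_tr c; have := @card_translation_fibers_in V S setT f _ c.
rewrite cardsT => <-; last first.
  by move=> d; have [h fh] := f_tr d; exists h; split=> x *; rewrite ?inE ?fh.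
by congr (_ * _)%N; apply: eq_card => x; rewrite !inE.
Qed.

(** * Second moment of the level sets of a quadratic form *)

Section SecondMoment.

Variables (V : finZmodType) (F : finFieldType).
Variables (Qf : V -> F) (bf : V -> V -> F) (R : {set V}) (A B : nat).

Hypothesis QfD : forall x h, Qf (x + h) = Qf x + Qf h + bf h x.
Hypothesis radQ : forall h, h \in R -> Qf h = 0.
Hypothesis radb : forall h x, h \in R -> bf h x = 0.
Hypothesis nradb :
  forall h c, h \notin R -> (#|F| * #|[set x | bf h x == c]| = #|V|)%N.
Hypothesis level0 : #|[set x | Qf x == 0%R]| = A.
Hypothesis level1 : forall c, c != 0 -> #|[set x | Qf x == c]| = B.

Lemma card_levels : (A + (#|F| - 1) * B = #|V|)%N.
Proof.
rewrite -(sum_card_fibers Qf) (bigD1 0) //= level0; congr (_ + _)%N.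
rewrite (eq_bigr (fun=> B)) => [|c c0]; last exact: level1.
by rewrite sum_nat_const cardC1 subn1.
Qed.

Lemma card_level_pairs :
  (#|[set p : V * V | Qf p.1 == Qf p.2]| = A ^ 2 + (#|F| - 1) * B ^ 2)%N.
Proof.
rewrite -sum1dep_card (partition_big (fun p => Qf p.2) predT) //=.
rewrite (eq_bigr (fun c => #|[set x | Qf x == c]| ^ 2)%N) => [|c _].
  rewrite (bigD1 0) //= level0; congr (_ + _)%N.
  rewrite (eq_bigr (fun=> B ^ 2)%N) => [|c c0]; last by rewrite level1.
  by rewrite sum_nat_const cardC1 subn1.
rewrite -mulnn -cardsX -sum1_card; apply: eq_bigl => -[x y] /=.
by rewrite !inE; apply/andP/andP => -[/eqP -> /eqP ->].
Qed.

(** For a fixed difference [h] of the pair, [Qf (x + h) = Qf x] is the affine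
    equation [bf h x = - Qf h]: it holds for every [x] if [h] is in the
    radical, and for one [x] out of [#|F|] otherwise. *)
Lemma card_level_pairs_shift :
  (#|F| * #|[set p : V * V | Qf p.1 == Qf p.2]|
   = #|F| * #|R| * #|V| + (#|V| - #|R|) * #|V|)%N.
Proof.
have -> : #|[set p : V * V | Qf p.1 == Qf p.2]|
       = (\sum_h #|[set x | bf h x == - Qf h]|)%N.
  rewrite -sum1dep_card.
  rewrite (reindex (fun p : V * V => (p.1 + p.2, p.1))) /=; last first.
    exists (fun p : V * V => (p.2, p.1 - p.2)) => -[x y] _ /=.
      by rewrite addrC addKr.
    by rewrite addrC subrK.
  rewrite (partition_big (fun p : V * V => p.2) predT) //=.
  apply: eq_bigr => h _; rewrite -sum1dep_card.
  rewrite (reindex_onto (fun x => (x, h)) (fun p : V * V => p.1)) /=.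
    apply: eq_bigl => x; rewrite !eqxx !andbT QfD -addrA addrC -subr_eq0 addrK.
    by rewrite addrC addr_eq0.
  by move=> [x y] /andP[_ /eqP /= ->].
rewrite (bigID (mem R)) /= mulnDr; congr (_ + _)%N.
  rewrite -mulnA; congr muln; rewrite -sum_nat_const; apply: eq_bigr => h hR.
  rewrite -cardsT; apply: eq_card => x.
  by rewrite !inE radb // radQ // oppr0 eqxx.
rewrite big_distrr /= (eq_bigr (fun=> #|V|)) => [|h hR]; last exact: nradb.
rewrite sum_nat_const; congr (_ * _)%N.
by rewrite -(cardsC R) addKn; apply: eq_card => h; rewrite !inE.
Qed.

(** The two counts of the pairs on the same level, by level and by difference,
    are [A ^ 2 + (q - 1) * B ^ 2] and [#|R| * #|V| + (#|V| - #|R|) * #|V| / q];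
    eliminating [#|V| = A + (q - 1) * B] leaves the square of [A - B]. *)
Lemma sqr_level_diff : (A%:Z - B%:Z) ^+ 2 = (#|V| * #|R|)%:Z.
Proof.
have q_gt1 : (1 < #|F|)%N := finNzRing_gt1 F.
have RV : (#|R| <= #|V|)%N := max_card _.
have eV := card_levels; have := card_level_pairs_shift.
rewrite card_level_pairs.
move: #|R| #|V| #|F| RV eV q_gt1 => r v q RV eV q_gt1 E.
have q1 : (q%:Z - 1) != 0 by lia.
apply: (mulfI q1).
have {}eV : v%:Z = A%:Z + (q%:Z - 1) * B%:Z by lia.
have {}E : q%:Z * (A%:Z ^+ 2 + (q%:Z - 1) * B%:Z ^+ 2)
   = q%:Z * r%:Z * v%:Z + (v%:Z - r%:Z) * v%:Z.
  by have := congr1 Posz E; rewrite -!mulnn !(PoszD, PoszM) -!subzn //; lia.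
rewrite PoszM; have {}E : (q%:Z - 1) * (r%:Z * v%:Z) =
   q%:Z * (A%:Z ^+ 2 + (q%:Z - 1) * B%:Z ^+ 2) - v%:Z ^+ 2 by rewrite E; ring.
rewrite [_ * r%:Z]mulrC E eV; ring.
Qed.

End SecondMoment.

(** For a vanishing sum in which [x] terms have the value [u] and the other [y]
    terms have the value [- u * D]. *)
Lemma card_of_balanced_sum (u : int) (D x y : nat) : u != 0 ->
  u *+ x + (- (u * D%:Z)) *+ y = 0 -> x = (D * y)%N.
Proof.
move=> u0; rewrite -[u *+ x]mulr_natr -[_ *+ y]mulr_natr !natz => E.
have {}E : u * (x%:Z - D%:Z * y%:Z) = 0 by rewrite -E; ring.
by apply/eqP; rewrite -eqz_nat PoszM -subr_eq0 -(mulrI_eq0 _ (mulfI u0)) E.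
Qed.

(** What remains of a double count of the orthogonal pairs between a subspace
    with [r] elements and the whole space, [p] being the size of the
    orthogonal. *)
Lemma double_count_cancel q p r M : (1 < q)%N -> (0 < r)%N -> (p <= M)%N ->
  (q * M + (r - 1) * M = q * (p * r) + (M - p) * r -> r * p = M)%N.
Proof.
move=> q_gt1 r_gt0 /subnKC <-; move: (M - p)%N => t; rewrite addKn.
case: r r_gt0 => // r _; case: q q_gt1 => // q; rewrite ltnS => q_gt0 E.
apply/eqP; rewrite -(eqn_pmul2l q_gt0); apply/eqP; move: E.
rewrite subn1 /=; lia.
Qed.

(** * Exponents modulo the order of the multiplicative group *)

(** Modulo a common divisor, the [a]-th and [b]-th powers of [q] are 1, hence by
    Bezout also its [gcdn a b]-th power. *)
Lemma gcdn_subX1 q a b : (0 < q)%N ->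
  gcdn (q ^ a - 1) (q ^ b - 1) = (q ^ gcdn a b - 1)%N.
Proof.
move=> q_gt0; case: (posnP a) => [->|a_gt0]; first by rewrite !gcd0n.
have subX1_dvd r s : (r %| s)%N -> (q ^ r - 1 %| q ^ s - 1)%N.
  by case/dvdnP=> k ->; rewrite mulnC expnM !subn1 dvdn_pred_predX.
apply/eqP; rewrite eqn_dvd dvdn_gcd !subX1_dvd ?dvdn_gcdl ?dvdn_gcdr // !andbT.
set d := gcdn (_ - 1) _.
have X1 s : (d %| q ^ s - 1)%N -> q ^ s = 1 %[mod d].
  by move=> ds; apply/eqP; rewrite eqn_mod_dvd // expn_gt0 q_gt0.
have qa : q ^ a = 1 %[mod d] by apply/X1/dvdn_gcdl.
have qb : q ^ b = 1 %[mod d] by apply/X1/dvdn_gcdr.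
have [u v uv _] := egcdnP b a_gt0.
rewrite -eqn_mod_dvd ?expn_gt0 ?q_gt0 //; apply/eqP.
have : q ^ (u * a) = 1 %[mod d] by rewrite mulnC expnM -modnXm qa modnXm exp1n.
rewrite uv expnD [(v * b)%N]mulnC [(q ^ (b * v))%N]expnM -modnMml -modnXm qb.
by rewrite modnXm exp1n modnMml mul1n.
Qed.

Lemma dvdz_expD1 (D : int) k : (D + 1 %| D ^+ k - (-1) ^+ k)%Z.
Proof. by rewrite subrXX opprK dvdz_mulr. Qed.

(** [D ^+ k] is [(-1) ^+ k] modulo [D + 1], so the two square roots of
    [D ^+ (2 * k)] are 1 and -1 modulo [D + 1], and these are distinct when
    [D > 1]. *)
Lemma sqr_expD1_sign (D : nat) (S : int) k : (1 < D)%N ->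
    S ^+ 2 = (D%:Z ^+ k) ^+ 2 -> (D%:Z + 1 %| S - 1)%Z ->
  S = (-1) ^+ k * D%:Z ^+ k.
Proof.
move=> D_gt1 S2 dvdS.
have sgn2 : (-1) ^+ k * (-1) ^+ k = 1 :> int by rewrite -expr2 sqrr_sign.
have : S ^+ 2 == ((-1) ^+ k * D%:Z ^+ k) ^+ 2.
  by rewrite S2 exprMn sqrr_sign mul1r.
rewrite eqf_sqr => /orP[/eqP // | /eqP SE].
have dvd1 : (D%:Z + 1 %| (-1) ^+ k * D%:Z ^+ k - 1)%Z.
  by rewrite -[X in _ - X]sgn2 -mulrBr dvdz_mull // dvdz_expD1.
have : (D%:Z + 1 %| (S - 1) + ((-1) ^+ k * D%:Z ^+ k - 1))%Z by rewrite rpredD.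
have -> : (S - 1) + ((-1) ^+ k * D%:Z ^+ k - 1) = - 2 by rewrite SE; ring.
by move/dvdn_leq => /(_ isT); lia.
Qed.

Lemma dvdn_expD1_odd D k : odd k -> (D + 1 %| D ^ k + 1)%N.
Proof.
move=> k_odd; have := dvdz_expD1 D k.
by rewrite -signr_odd k_odd expr1 opprK -rmorphXn.
Qed.

(** The cofactors [m / delta] and [l / delta] are coprime and the first one is
    even, so the second one is odd. *)
Lemma even_cofactor m l (delta := gcdn m l) :
    (0 < l)%N -> ~~ odd (m %/ delta) ->
  odd (l %/ delta) /\ gcdn l.*2 m = delta.*2.
Proof.
move=> l_gt0; have d_gt0 : (0 < delta)%N by rewrite gcdn_gt0 l_gt0 orbT.
have co : coprime (m %/ delta) (l %/ delta).
  rewrite /coprime -(eqn_pmul2l d_gt0) muln_gcdr ![(delta * _)%N]mulnC.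
  by rewrite !divnK ?dvdn_gcdl ?dvdn_gcdr // mul1n.
have Em : (m = m %/ delta * delta)%N by rewrite divnK ?dvdn_gcdl.
have El : (l = l %/ delta * delta)%N by rewrite divnK ?dvdn_gcdr.
move: co Em El; move: (m %/ delta)%N (l %/ delta)%N => m' l' co Em El m'even.
have l'odd : odd l'.
  apply: contraLR co => l'even; apply/negP => co.
  have : (2 %| gcdn m' l')%N by rewrite dvdn_gcd !dvdn2 m'even.
  by rewrite (eqP co).
split=> //; clearbody delta; rewrite Em El doubleMl -muln_gcdl; move: co.
rewrite -(odd_double_half m') (negPf m'even) add0n -!muln2 -muln_gcdl.
by rewrite coprimeMl gcdnC => /andP[/eqP -> _]; rewrite mul1n mulnC.
Qed.

Lemma subn_expX1_double q s :
  (q ^ s.*2 - 1 = (q ^ s - 1) * (q ^ s + 1))%N.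
Proof. by rewrite -muln2 expnM -{2}(exp1n 2) subn_sqr. Qed.

(** Since [l / delta] is odd, [q ^ l] and [q ^ delta] agree modulo
    [q ^ (2 * delta) - 1], hence modulo any common divisor of [q ^ l + 1] and
    [q ^ m - 1]. *)
Lemma gcdn_expD1 q m l (delta := gcdn m l) :
    (1 < q)%N -> (0 < l)%N -> ~~ odd (m %/ delta) ->
  (q ^ delta + 1 %| q ^ l + 1)%N /\
  gcdn (q ^ l + 1) (q ^ m - 1) = (q ^ delta + 1)%N.
Proof.
move=> q_gt1 l_gt0 m'even; have [l'odd g2] := even_cofactor l_gt0 m'even.
have q_gt0 := ltnW q_gt1.
have El : (l = l %/ delta * delta)%N by rewrite divnK ?dvdn_gcdr.
have dvdl : (q ^ delta + 1 %| q ^ l + 1)%N.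
  by rewrite {1}El mulnC expnM dvdn_expD1_odd.
split=> //; apply/eqP; rewrite eqn_dvd dvdn_gcd dvdl /=.
apply/andP; split; last first.
  apply: dvdn_trans (_ : q ^ delta.*2 - 1 %| _)%N.
    by rewrite subn_expX1_double dvdn_mull.
  by rewrite -g2 -gcdn_subX1 // dvdn_gcdr.
set d := gcdn _ _.
have d1 : (d %| q ^ delta.*2 - 1)%N.
  rewrite -g2 -gcdn_subX1 // dvdn_gcd dvdn_gcdr andbT subn_expX1_double.
  by rewrite dvdn_mull ?dvdn_gcdl.
have q2 : q ^ delta.*2 = 1 %[mod d].
  by apply/eqP; rewrite eqn_mod_dvd // expn_gt0 q_gt0.
have : (d %| q ^ l + 1)%N by apply: dvdn_gcdl.
have -> : (l = delta + delta.*2 * (l %/ delta)./2)%N.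
  rewrite {1}El -{1}(odd_double_half (l %/ delta)) l'odd; clear; nia.
rewrite expnD expnM /dvdn -modnDml -modnMmr -modnXm q2 modnXm exp1n modnMmr.
by rewrite muln1 modnDml.
Qed.

(** Gives divisibility of a count by [k] from a free action of a cyclic group of
    order [k], once nonzero elements are written as powers of a generator. *)
Lemma sum_periodic (f : nat -> nat) n k : (forall j, f (j + n)%N = f j) ->
  (\sum_(j < k * n) f j = k * \sum_(j < n) f j)%N.
Proof.
move=> fn; rewrite -!(big_mkord predT f).
elim: k => [|k IHk]; first by rewrite !mul0n big_geq.
rewrite !mulSn (@big_cat_nat _ _ _ n) ?leq_addr //=; congr addn.
rewrite -IHk -{1}[n]add0n big_addn addKn.
by apply: eq_bigr => j _.
Qed.

Section Cyclic.

Variables (K : finFieldType) (a : K) (N : nat).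
Hypothesis card_K : #|K| = N.+1.
Hypothesis prim_a : N.-primitive_root a.

Lemma prim_exp (x : K) : x != 0 -> exists i : nat, x = a ^+ i.
Proof.
move=> x0; have xN : x ^+ N = 1.
  by apply: (mulIf x0); rewrite -exprSr -card_K expf_card mul1r.
by have [i ->] := prim_rootP prim_a xN; exists i.
Qed.

Lemma prim_neq0 i : a ^+ i != 0.
Proof.
apply: expf_neq0; apply: contraNneq (oner_neq0 K) => a0.
by rewrite -(prim_expr_order prim_a) a0 expr0n eqn0Ngt (prim_order_gt0 prim_a).
Qed.

Lemma sum_prim (f : K -> nat) :
  (\sum_(x | x != 0%R) f x = \sum_(j < N) f (a ^+ j))%N.
Proof.
rewrite (reindex_onto (fun j : 'I_N => a ^+ j)
  (fun x => odflt (Ordinal (prim_order_gt0 prim_a))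
                  [pick j : 'I_N | x == a ^+ j])) /=.
  apply: eq_bigl => j; rewrite prim_neq0 /=.
  case: pickP => [k /= /eqP/esym/eqP|/(_ j)]; last by rewrite eqxx.
  by rewrite (eq_prim_root_expr prim_a) !modn_small // => /eqP/val_inj->;
    rewrite eqxx.
move=> x x0; case: pickP => [k /= /eqP->//|nx].
have xN : x ^+ N = 1.
  by apply: (mulIf x0); rewrite -exprSr -card_K expf_card mul1r.
by have [i xE] := prim_rootP prim_a xN; have := nx i; rewrite xE eqxx.
Qed.

Lemma card_roots_of_unity k : (k %| N)%N -> #|[set x : K | x ^+ k == 1]| = k.
Proof.
move=> kN; have prim_b := dvdn_prim_root prim_a kN.
set b := a ^+ _ in prim_b.
rewrite -[RHS]card_ord -(card_imset _ (_ : injective (fun i : 'I_k => b ^+ i))).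
  apply: eq_card => x; rewrite inE; apply/eqP/imsetP => [xk|[i _ ->]].
    by have [i ->] := prim_rootP prim_b xk; exists i.
  by rewrite exprAC (prim_expr_order prim_b) expr1n.
move=> i j /eqP; rewrite (eq_prim_root_expr prim_b) !modn_small //.
by move/eqP/val_inj.
Qed.

Lemma expr_gcdn_eq1 (x : K) k : x != 0 -> (x ^+ gcdn k N == 1) = (x ^+ k == 1).
Proof.
move/prim_exp => [i ->]; rewrite -!exprM -!(prim_order_dvd prim_a).
by rewrite muln_gcdr dvdn_gcd (dvdn_mull i (dvdnn N)) andbT.
Qed.

Lemma exists_root e i : (gcdn e N %| i)%N -> exists t, t ^+ e = a ^+ i.
Proof.
case/dvdnP=> k ->; have [->|e_gt0] := posnP e.
  by exists 1; rewrite expr0 gcd0n exprM exprAC (prim_expr_order prim_a) expr1n.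
have [u v uv _] := egcdnP N e_gt0; exists (a ^+ (u * k)).
rewrite -exprM -mulnA [(k * e)%N]mulnC mulnA uv mulnDl exprD.
rewrite mulnAC mulnC exprM (prim_expr_order prim_a) expr1n mul1r.
by rewrite mulnC.
Qed.

End Cyclic.

(** * The quadratic forms of the codes *)

Section Form.

Variables (F : finFieldType) (L : fieldExtType F) (l : nat).
Local Notation K := (finvect_type L).
Local Notation Tr := (@Tr F L).
Local Notation codeword := (@codeword F L).
Local Notation q := #|F|.
Local Notation m := (\dim {:L}).
Local Notation delta := (gcdn m l).

Implicit Types g h x y : K.

Lemma card_Tr_fiber (b : K) c : b != 0 ->
  (q * #|[set x : K | Tr (b * x) == c]| = #|K|)%N.
Proof.
move=> b0; apply: card_translation_fibers => d; have [t Tt] := Tr_neq0 L.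
exists ((d / Tr t) *: (t / b)) => x.
by rewrite mulrDr TrD -scalerAr mulrCA divff // mulr1 TrZ divfK.
Qed.

Definition qform (g x : K) : F := Tr (g * x ^+ (q ^ l + 1)).

(** The adjoint form of the polarisation: [y |-> y ^+ (q ^ (m - l))] is the
    inverse of [y |-> y ^+ (q ^ l)], and moving it across the trace isolates
    [x] in [Tr (g * h * x ^+ (q ^ l))]. *)
Definition polar (g h : K) : K := g * h ^+ (q ^ l) + (g * h) ^+ (q ^ (m - l)).

Definition radical (g : K) : {set K} := [set h | polar g h == 0].

Lemma polarD g x y : polar g (x + y) = polar g x + polar g y.
Proof. by rewrite /polar frobD !mulrDr frobD addrACA. Qed.

Lemma polarZ g c x : polar g (c *: x) = c *: polar g x.
Proof. by rewrite /polar exprZn -!scalerAr exprZn !expf_cardX -scalerDr. Qed.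

Lemma polar0 g : polar g 0 = 0.
Proof. by have := polarZ g 0 0; rewrite !scale0r. Qed.

Lemma radical0 g : 0 \in radical g.
Proof. by rewrite inE polar0. Qed.

Hypothesis l2_lt_m : (l.*2 < m)%N.

Let l_lt_m : (l < m)%N.
Proof. by apply: leq_ltn_trans l2_lt_m; rewrite -addnn leq_addr. Qed.

Lemma qformD g x h :
  qform g (x + h) = qform g x + qform g h + Tr (polar g h * x).
Proof.
have -> : Tr (polar g h * x)
        = Tr (g * h ^+ (q ^ l) * x) + Tr (g * h * x ^+ (q ^ l)).
  rewrite mulrDl TrD; congr (_ + _).
  rewrite -[RHS](Tr_frob _ (m - l)) [X in _ = Tr X]exprMn.
  by rewrite -[X in _ = Tr (_ * X)]exprM -expnD subnKC ?frob_id // ltnW.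
rewrite /qform -!TrD; congr Tr; rewrite !exprD !expr1 frobD; ring.
Qed.

Lemma polar_sym g h x : Tr (polar g h * x) = Tr (polar g x * h).
Proof.
have := qformD g x h; rewrite [x + h]addrC qformD [qform g h + _]addrC.
by move/addrI.
Qed.

Hypotheses (l_gt0 : (0 < l)%N) (cof_even : ~~ odd (m %/ delta)).

Local Notation D := (q ^ delta)%N.
Local Notation k := (m %/ delta)./2.
Local Notation X := (q ^ (m./2 - delta - 1))%N%:Z.
Local Notation Q := (q%:Z).
Local Notation Dz := (D%:Z).
Local Notation e := ((-1) ^+ k : int).

Let q_gt1 : (1 < q)%N := finNzRing_gt1 F.

Let delta_gt0 : (0 < delta)%N.
Proof. by rewrite gcdn_gt0 l_gt0 orbT. Qed.

Let D_gt1 : (1 < D)%N.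
Proof. by rewrite -{1}(expn0 q) ltn_exp2l. Qed.

Lemma half_dim : m./2 = (delta * k)%N /\ (delta < m./2)%N /\ m = m./2.*2.
Proof.
have := odd_double_half (m %/ delta); rewrite (negPf cof_even) add0n => cofE.
have mE : m = (delta * k).*2 by rewrite doubleMr cofE mulnC divnK ?dvdn_gcdl.
split; first by rewrite {1}mE doubleK.
have : (delta <= l)%N by rewrite dvdn_leq ?dvdn_gcdr.
move: mE l2_lt_m; move: (delta * k)%N delta => x y ->; rewrite doubleK; lia.
Qed.

Lemma card_ext_sqr : (q ^ m = (D ^ k) ^ 2)%N.
Proof.
rewrite -!expnM; congr (_ ^ _)%N.
have := odd_double_half (m %/ delta); rewrite (negPf cof_even) add0n => cofE.
by rewrite muln2 cofE mulnC divnK ?dvdn_gcdl.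
Qed.

(** [D], [X] and [Q] are the monomials in which all the powers of [q] of the
    weight tables are expressed: [q ^ (m / 2) = Q * D * X]. *)
Lemma exprD_half : Dz ^+ k = Q * Dz * X.
Proof.
rewrite -rmorphXn -!PoszM; congr Posz.
change (D ^ k = q * D * q ^ (m./2 - delta - 1))%N.
rewrite -expnM -expnS -expnD; congr (_ ^ _)%N.
have [mE [dlt _]] := half_dim; move: dlt; rewrite mE; lia.
Qed.

Lemma card_ext_factor : (q ^ m)%:Z = (Q * Dz * X) ^+ 2.
Proof. by rewrite -exprD_half card_ext_sqr -!rmorphXn. Qed.

Lemma card_hyperplane : (q ^ (m - 1))%N%:Z = Q * (Dz * X) ^+ 2.
Proof.
have q0 : Q != 0 by have := q_gt1; lia.
apply: (mulfI q0).
rewrite -[LHS]PoszM -expnS subn1 prednK ?dim_ext_gt0 // card_ext_factor.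
by ring.
Qed.

Variables (a : K) (N : nat).
Hypothesis card_K : #|K| = N.+1.
Hypothesis prim_a : N.-primitive_root a.

Let N_def : N = (q ^ m - 1)%N.
Proof. by rewrite -card_ext card_K subn1. Qed.

(** Raise [polar g h = 0] to the power [q ^ l], which undoes the inverse
    Frobenius of its second term, and multiply by [h ^+ (q ^ l)]. *)
Lemma radical_neq0 g h : h != 0 ->
  (h \in radical g)
    = ((g * h ^+ (q ^ l + 1)) ^+ (q ^ l) == - (g * h ^+ (q ^ l + 1))).
Proof.
move=> h0; rewrite inE; pose y := polar g h.
have -> : (y == 0) = (y ^+ (q ^ l) * h ^+ (q ^ l) == 0).
  by rewrite mulf_eq0 !expf_eq0 (negPf h0) andbF orbF expn_gt0 ltnW.
rewrite frobD -[_ ^+ _ ^+ _ in X in _ + X]exprM -expnD subnK ?(ltnW l_lt_m) //.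
rewrite frob_id mulrDl -exprMn -[g * h * _]mulrA -exprS -[g * _ * h]mulrA.
by rewrite -exprSr -addn1 addr_eq0.
Qed.

(** If [h0] is a nonzero element of the radical, [z * h0] is another one iff
    [z ^+ ((q ^ l + 1) * (q ^ l - 1)) = 1], that is iff
    [z ^+ (q ^ (2 * delta) - 1) = 1]. *)
Lemma card_radical g : g != 0 ->
  #|radical g| = 1%N \/ #|radical g| = (q ^ delta.*2)%N.
Proof.
move=> g0; have [/existsP[h0 /andP[h0nz h0R]]|noR] :=
  boolP [exists h, (h != 0) && (h \in radical g)]; [right|left]; last first.
  apply/eqP/cards1P; exists 0; apply/setP=> h; rewrite !inE.
  apply/idP/eqP => [hR|->]; last by rewrite polar0.
  apply: contraNeq noR => h0; apply/existsP; exists h.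
  by rewrite h0 inE.
have kN : (q ^ delta.*2 - 1 %| N)%N.
  have [_ <-] := even_cofactor l_gt0 cof_even.
  by rewrite N_def -gcdn_subX1 ?(ltnW q_gt1) // dvdn_gcdr.
have qX_gt0 : (0 < q ^ delta.*2)%N by rewrite expn_gt0 ltnW.
rewrite (cardsD1 0) radical0 -(subnKC qX_gt0).
congr addn; rewrite -(card_roots_of_unity prim_a kN).
rewrite -[RHS](card_imset _ (mulIf h0nz)); apply/eq_card=> x; apply/esym.
have roots z : z != 0 ->
    (z * h0 \in radical g) = (z ^+ (q ^ delta.*2 - 1) == 1).
  move=> z0; rewrite radical_neq0 ?mulf_neq0 //.
  move: h0R; rewrite radical_neq0 // => /eqP h0R.
  rewrite [(z * h0) ^+ _]exprMn mulrCA exprMn h0R -exprM mulrN eqr_opp.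
  rewrite -subr_eq0 -mulrBl.
  rewrite mulf_eq0 mulf_eq0 (negPf g0) expf_eq0 (negPf h0nz) andbF !orbF.
  have [_ <-] := even_cofactor l_gt0 cof_even.
  rewrite -(gcdn_subX1 _ _ (ltnW q_gt1)) -N_def.
  rewrite (expr_gcdn_eq1 card_K prim_a) //.
  have -> : ((q ^ l + 1) * q ^ l = q ^ l + 1 + (q ^ l.*2 - 1))%N.
    by rewrite -addnn expnD mulnDl mul1n; have : (0 < q ^ l)%N;
      [rewrite expn_gt0 ltnW | nia].
  rewrite exprD -{2}[z ^+ (_ + 1)]mulr1 -mulrBr mulf_eq0 expf_eq0 (negPf z0).
  by rewrite andbF subr_eq0.
apply/imsetP/idP => [[z + ->]|].
  rewrite inE => z1; have z0 : z != 0.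
    apply: contraTneq z1 => ->; rewrite expr0n subn_eq0 leqNgt.
    rewrite -{1}(expn0 q) ltn_exp2l // double_gt0 gcdn_gt0 l_gt0 orbT /=.
    by rewrite eq_sym oner_eq0.
  by rewrite !inE mulf_neq0 //=; have := roots z z0; rewrite inE => ->.
rewrite !inE => /andP[x0 xR]; exists (x / h0); last by rewrite divfK.
by rewrite inE -roots ?mulf_neq0 ?invr_eq0 // divfK // inE.
Qed.

(** Such a [t] exists iff the discrete logarithm of [c] is divisible by
    [gcd (q ^ l + 1, N) = q ^ delta + 1].  It is a multiple of
    [N / (q - 1)], hence of [(q ^ (2 * delta) - 1) / (q - 1)], hence of
    [q ^ delta + 1]. *)
Lemma exists_norm c : c != 0 -> exists t : K, t ^+ (q ^ l + 1) = c%:A.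
Proof.
move=> c0; have cA0 : c%:A != 0 :> K by rewrite scaler_eq0 (negPf c0) oner_eq0.
have [i ci] := prim_exp card_K prim_a cA0; rewrite ci.
apply: (exists_root prim_a); have [_] := gcdn_expD1 q_gt1 l_gt0 cof_even.
rewrite -N_def => ->.
have : (N %| i * (q - 1))%N.
  rewrite (prim_order_dvd prim_a) exprM -ci.
  rewrite -(inj_eq (mulIf cA0)) -exprSr -addn1 subnK ?(ltnW q_gt1) // mul1r.
  by rewrite exprZn expr1n expf_card.
have q1 : (0 < q - 1)%N by rewrite subn_gt0.
move=> Ni; rewrite -(dvdn_pmul2r q1); apply: dvdn_trans Ni.
rewrite N_def; have [_ g2] := even_cofactor l_gt0 cof_even.
apply: (@dvdn_trans (q ^ delta.*2 - 1)); last first.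
  by rewrite -g2 -gcdn_subX1 ?(ltnW q_gt1) // dvdn_gcdr.
rewrite subn_expX1_double mulnC dvdn_mul //.
by rewrite !subn1 dvdn_pred_predX.
Qed.

(** If [t ^+ (q ^ l + 1) = c], substituting [t * x] for [x] multiplies the form
    by [c]. *)
Lemma card_level_scale g c : c != 0 ->
  #|[set x | qform g x == c]| = #|[set x | qform g x == 1]|.
Proof.
move=> c0; have [t tc] := exists_norm c0.
have t0 : t != 0.
  apply: contraNneq c0 => t0; move/eqP: tc; rewrite t0 expr0n addn1 /= eq_sym.
  by rewrite scaler_eq0 oner_eq0 orbF.
rewrite -!sum1dep_card (reindex_inj (mulfI t0)) /=; apply: eq_bigl => x.
rewrite /qform exprMn tc mulrCA -scalerAl mul1r TrZ.
by rewrite -{2}[c]mulr1 (inj_eq (mulfI c0)).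
Qed.

(** Multiplying [x] by a root of unity [w] with [w ^+ (q ^ delta + 1) = 1] does
    not change [x ^+ (q ^ l + 1)], and moves every nonzero [x]. *)
Lemma dvdn_card_level g c : c != 0 ->
  (q ^ delta + 1 %| #|[set x | qform g x == c]|)%N.
Proof.
move=> c0; have [dvdl gN] := gcdn_expD1 q_gt1 l_gt0 cof_even.
have : (q ^ delta + 1 %| N)%N by rewrite N_def -gN dvdn_gcdr.
case/dvdnP=> n Nn.
have -> : #|[set x | qform g x == c]|
    = (\sum_(j < N) (qform g (a ^+ j) == c))%N.
  rewrite -(sum_prim card_K prim_a (fun x => nat_of_bool (qform g x == c))).
  rewrite -sum1dep_card [RHS]big_mkcond [LHS]big_mkcond; apply: eq_bigr => x _.
  have [->|_] := eqVneq x 0; last by case: (qform g x == c).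
  by rewrite /qform expr0n addn1 mulr0 Tr0 eq_sym (negPf c0).
rewrite Nn mulnC (@sum_periodic (fun j => qform g (a ^+ j) == c : nat)) => [|j].
  by rewrite dvdn_mulr.
have an : a ^+ n ^+ (q ^ l + 1) = 1.
  case/dvdnP: dvdl => k ->; rewrite -exprM mulnCA -Nn mulnC exprM.
  by rewrite (prim_expr_order prim_a) expr1n.
by rewrite /qform [a ^+ (j + n)]exprD exprMn an mulr1.
Qed.

Definition level0 g := #|[set x | qform g x == 0]|.
Definition level1 g := #|[set x | qform g x == 1]|.

Lemma card_qform_levels g : (level0 g + (q - 1) * level1 g = q ^ m)%N.
Proof.
rewrite -card_ext; apply: (@card_levels _ _ (qform g)) => // c.
exact: card_level_scale.
Qed.

(** If the form had a value [c != 0] at [h] in the radical, translation by [h]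
    would identify the zero level with the level [c]; then all levels would have
    [q ^ (m - 1)] elements, a number prime to [q ^ delta + 1]. *)
Lemma qform_radical g h : h \in radical g -> qform g h = 0.
Proof.
move=> hR; apply/eqP/negPn/negP => c0.
have level_eq : level0 g = level1 g.
  rewrite /level1 -(card_level_scale g c0) /level0.
  rewrite -!sum1dep_card [RHS](reindex_inj (addIr h)) /=; apply: eq_bigl => x.
  move: hR; rewrite qformD inE => /eqP ->; rewrite mul0r Tr0 addr0.
  by rewrite -[X in _ = (_ == X)]add0r (inj_eq (addIr _)).
have := card_qform_levels g.
rewrite level_eq -mulSn -addn1 subnK ?(ltnW q_gt1) // => qB.
 have : (q ^ delta + 1 %| q ^ m)%N.
  by rewrite -qB dvdn_mull // dvdn_card_level ?oner_neq0.
have : coprime (q ^ delta + 1) (q ^ m).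
  rewrite coprimeXr // -(prednK delta_gt0) expnS -coprime_modl mulnC modnMDl.
  by rewrite coprime_modl coprime1n.
move=> /eqP co /gcdn_idPl; rewrite co => /eqP.
by rewrite -{1}[1%N]add0n eqn_add2r eq_sym expn_eq0 -leqn0 leqNgt ltnW.
Qed.

Lemma sqr_qform_level_diff g :
  ((level0 g)%:Z - (level1 g)%:Z) ^+ 2 = (q ^ m * #|radical g|)%:Z.
Proof.
rewrite -card_ext.
apply: (@sqr_level_diff _ _ (qform g) (fun h x => Tr (polar g h * x))) => //.
- by move=> x h; apply: qformD.
- by move=> h; apply: qform_radical.
- by move=> h x; rewrite inE => /eqP ->; rewrite mul0r Tr0.
- by move=> h c; rewrite inE; apply: card_Tr_fiber.
- by move=> c; apply: card_level_scale.
Qed.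

(** The size of a nonzero level is divisible by [q ^ delta + 1], as is
    [q ^ m - 1]; hence the difference of the levels, which is known up to sign,
    is 1 modulo [q ^ delta + 1]. *)
Lemma qform_level_diff g : g != 0 ->
  (#|radical g| = 1%N /\
     (level0 g)%:Z - (level1 g)%:Z = (-1) ^+ k * D%:Z ^+ k) \/
  (#|radical g| = (D ^ 2)%N /\
     (level0 g)%:Z - (level1 g)%:Z = (-1) ^+ k.+1 * D%:Z ^+ k.+1).
Proof.
move=> g0; set S := _ - _.
have dvdS : (D%:Z + 1 %| S - 1)%Z.
  have -> : S - 1 = N%:Z - q%:Z * (level1 g)%:Z.
    rewrite N_def -subzn ?expn_gt0 ?(ltnW q_gt1) // -(card_qform_levels g).
    by rewrite PoszD PoszM -subzn ?(ltnW q_gt1) // /S; ring.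
  have [_ gN] := gcdn_expD1 q_gt1 l_gt0 cof_even.
  rewrite rpredB //; first by rewrite -PoszD dvdzE /= N_def -gN dvdn_gcdr.
  by rewrite dvdz_mull // -PoszD dvdzE /= dvdn_card_level ?oner_neq0.
have := sqr_qform_level_diff g; rewrite -/S card_ext_sqr.
have [-> SE|-> SE] := card_radical g0; [left|right]; split=> //;
  try (by rewrite -muln2 expnM); apply: sqr_expD1_sign => //; rewrite SE.
  by rewrite muln1 -!rmorphXn.
by rewrite -muln2 expnM -expnMn -expnSr -!rmorphXn.
Qed.

(** For a fixed [x != 0], the condition [qform g x = 0] is a nonzero linear
    equation in [g]. *)
Lemma sum_level0 : (q * \sum_g level0 g = q * q ^ m + N * q ^ m)%N.
Proof.
have -> : (\sum_g level0 g
         = \sum_x #|[set g : K | Tr (x ^+ (q ^ l + 1) * g) == 0%R]|)%N.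
  rewrite /level0; under eq_bigr do rewrite -sum1dep_card big_mkcond.
  rewrite exchange_big /=; apply: eq_bigr => x _.
  rewrite -sum1dep_card [RHS]big_mkcond; apply: eq_bigr => g _.
  by rewrite /qform mulrC.
rewrite (bigD1 0) //= mulnDr -card_ext; congr (_ * _ + _)%N.
  rewrite -cardsT; apply: eq_card => g.
  by rewrite !inE expr0n addn1 mul0r Tr0 eqxx.
rewrite big_distrr /= (eq_bigr (fun=> #|K|)) => [|x x0].
  by rewrite sum_nat_const cardC1 card_K.
by rewrite card_Tr_fiber // expf_neq0.
Qed.

Definition nonsingular := [set g : K | (g != 0) && (#|radical g| == 1%N)].
Definition singular := [set g : K | (g != 0) && (#|radical g| != 1%N)].

(** By [sum_level0] the differences of levels have sum 0 over [g != 0]; they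
    are [u] for the nonsingular forms and [- u * D] for the singular ones. *)
Lemma card_nonsingular : #|nonsingular| = (D * #|singular|)%N.
Proof.
have diff0 : \sum_(g : K | g != 0) ((level0 g)%:Z - (level1 g)%:Z) = 0.
  have q1 : (q%:Z - 1) != 0 by have := q_gt1; lia.
  apply: (mulfI q1); rewrite mulr0 mulr_sumr.
  transitivity (\sum_(g : K | g != 0) (q%:Z * (level0 g)%:Z - (q ^ m)%:Z)).
    apply: eq_bigr => g _; rewrite -(card_qform_levels g).
    by rewrite PoszD PoszM -subzn ?(ltnW q_gt1) //; ring.
  rewrite sumrB -mulr_sumr sumr_const cardC1 card_K /=.
  have := sum_level0; rewrite (bigD1 0) //=.
  have -> : level0 0 = (q ^ m)%N.
    rewrite -card_ext -cardsT; apply: eq_card => x.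
    by rewrite !inE /qform mul0r Tr0 eqxx.
  move/(congr1 Posz); rewrite mulnDr !PoszD => /addrI; rewrite PoszM.
  rewrite (big_morph Posz PoszD (erefl _)) => ->.
  by rewrite PoszM -mulr_natl natz subrr.
have D0 : (-1) ^+ k * D%:Z ^+ k != 0 by rewrite mulf_neq0 ?expf_neq0 //; lia.
move: diff0; rewrite (bigID (fun g => #|radical g| == 1%N)) /=.
rewrite (eq_bigr (fun=> (-1) ^+ k * D%:Z ^+ k)); last first.
  move=> g /andP[g0 /eqP R1].
  have [[_ //]|[R2 _]] := qform_level_diff g0.
  by have := D_gt1; rewrite R1 in R2; nia.
rewrite [X in _ + X](eq_bigr (fun=> (-1) ^+ k.+1 * D%:Z ^+ k.+1)); last first.
  by move=> g /andP[g0 /eqP R1]; have [[]|[]] := qform_level_diff g0.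
rewrite !sumr_const.
have -> : (-1) ^+ k.+1 * D%:Z ^+ k.+1 = - ((-1) ^+ k * D%:Z ^+ k * D%:Z).
  by rewrite !exprS; ring.
move/(card_of_balanced_sum D0) => DE.
transitivity #|[pred g : K | (g != 0) && (#|radical g| == 1%N)]|.
  by apply: eq_card => g; rewrite !inE.
by rewrite [LHS]DE; congr (_ * _)%N; apply: eq_card => g; rewrite !inE.
Qed.

Definition polar_image g := [set polar g u | u in K].

Lemma card_polar_fiber g u : #|[set x | polar g x == polar g u]| = #|radical g|.
Proof.
rewrite -!sum1_card [LHS](reindex_inj (addIr u)) /=; apply: eq_bigl => x.
by rewrite !inE polarD -[X in _ == X]add0r (inj_eq (addIr _)).
Qed.

Lemma sum_polar_image g (H : K -> int) :
  \sum_u H (polar g u) = #|radical g|%:Z * \sum_(b in polar_image g) H b.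
Proof.
rewrite (partition_big (polar g) (mem (polar_image g))) /=; last first.
  by move=> u _; apply: imset_f.
rewrite mulr_sumr; apply: eq_bigr => b /imsetP[u _ ->].
rewrite (eq_bigr (fun=> H (polar g u))) => [|x /eqP-> //].
rewrite sumr_const -[LHS]mulr_natl natz -(card_polar_fiber g u).
by congr (Posz _ * _); apply: eq_card => x; rewrite inE.
Qed.

Lemma card_polar_image g : (#|radical g| * #|polar_image g| = q ^ m)%N.
Proof.
have := sum_polar_image g (fun=> 1); rewrite !sumr_const !natz -PoszM -card_ext.
by case.
Qed.

Definition radical_perp g :=
  [set b : K | [forall h in radical g, Tr (b * h) == 0]].

Lemma radicalD g h x : h \in radical g ->
  (x + h \in radical g) = (x \in radical g).
Proof. by rewrite !inE polarD => /eqP ->; rewrite addr0. Qed.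

Lemma radicalZ g c h : h \in radical g -> c *: h \in radical g.
Proof. by rewrite !inE polarZ => /eqP ->; rewrite scaler0. Qed.

(** Double count of the orthogonal pairs between the radical and the whole
    field. *)
Lemma card_radical_perp g : (#|radical g| * #|radical_perp g| = q ^ m)%N.
Proof.
set r := #|radical g|; set p := #|radical_perp g|.
have p_le : (p <= q ^ m)%N by rewrite -card_ext max_card.
have r_gt0 : (0 < r)%N by apply/card_gt0P; exists 0; rewrite radical0.
have byb : (q * \sum_(b : K) #|[set h in radical g | Tr (b * h) == 0%R]|
          = q * (p * r) + (q ^ m - p) * r)%N.
  rewrite (bigID (mem (radical_perp g))) /= mulnDr; congr (_ + _)%N.
    congr (_ * _)%N; rewrite -sum_nat_const; apply: eq_bigr => b.
    rewrite inE => /forall_inP b0; apply: eq_card => h; rewrite [LHS]inE.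
    by have [hR|//] := boolP (h \in radical g); rewrite b0.
  rewrite big_distrr /= (eq_bigr (fun=> r)) => [|b].
    rewrite sum_nat_const -card_ext; congr (_ * _)%N.
    rewrite -(cardsC (radical_perp g)) addKn.
    by apply: eq_card => b; rewrite [RHS]inE.
  rewrite inE negb_forall_in => /exists_inP[h hR bh].
  apply: card_translation_fibers_in => d.
  exists ((d / Tr (b * h)) *: h); split=> [x|x _].
    by rewrite radicalD // radicalZ.
  by rewrite mulrDr TrD -scalerAr TrZ divfK.
have byh : (q * \sum_(b : K) #|[set h in radical g | Tr (b * h) == 0%R]|
          = q * q ^ m + (r - 1) * q ^ m)%N.
  under eq_bigr do rewrite -sum1dep_card big_mkcondr.
  rewrite exchange_big /= (bigD1 0) ?radical0 //= mulnDr -card_ext.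
  congr (_ + _)%N.
    congr (_ * _)%N; rewrite -sum1_card; apply: eq_bigr => b _.
    by rewrite mulr0 Tr0 eqxx.
  rewrite big_distrr /= (eq_bigr (fun=> #|K|)) => [|h /andP[hR h0]].
    rewrite sum_nat_const; congr (_ * _)%N.
    rewrite /r (cardsD1 0) radical0 add1n subn1 /=.
    by apply: eq_card => h; rewrite [LHS]inE [RHS]inE in_set1 andbC.
  rewrite -big_mkcond /= sum1dep_card -(card_Tr_fiber 0 h0).
  by congr (_ * _)%N; apply: eq_card => b; rewrite !inE mulrC.
apply: (double_count_cancel q_gt1 r_gt0 p_le); by rewrite -byb -byh.
Qed.

(** [polar g] is self-adjoint, so its image is orthogonal to its kernel; both
    sets have [q ^ m / #|radical g|] elements. *)
Lemma radical_perpE g : radical_perp g = polar_image g.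
Proof.
apply/esym/eqP; rewrite eqEcard; apply/andP; split.
  apply/subsetP=> _ /imsetP[u _ ->]; rewrite inE; apply/forall_inP=> h.
  by rewrite inE polar_sym => /eqP ->; rewrite mul0r Tr0.
have r_gt0 : (0 < #|radical g|)%N.
  by apply/card_gt0P; exists 0; rewrite radical0.
by rewrite -(leq_pmul2l r_gt0) card_radical_perp card_polar_image.
Qed.

Definition zeros g b c := #|[set x : K | qform g x + Tr (b * x) + c == 0]|.

(** Completing the square: [qform g x + Tr (polar g u * x)] is
    [qform g (x + u) - qform g u]. *)
Lemma zeros_polar g u c :
  zeros g (polar g u) c = #|[set x | qform g x == qform g u - c]|.
Proof.
rewrite /zeros -!sum1dep_card [RHS](reindex_inj (addIr u)) /=.
apply: eq_bigl => x; rewrite qformD -[RHS]subr_eq0 opprB.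
by rewrite [_ + qform g u + _]addrAC -[_ + _ + (c - _)]addrA subrKC.
Qed.

(** Some [h] of the radical has [Tr (b * h) != 0]; translations by multiples of
    [h] shift the function by arbitrary constants. *)
Lemma zeros_nonpolar g b c : b \notin polar_image g ->
  zeros g b c = (q ^ (m - 1))%N.
Proof.
rewrite -radical_perpE inE negb_forall_in => /exists_inP[h hR bh].
have q_gt0 := ltnW q_gt1; apply/eqP; rewrite -(eqn_pmul2l q_gt0) -expnS.
rewrite subn1 prednK ?dim_ext_gt0 // -card_ext /zeros; apply/eqP.
apply: (@card_translation_fibers _ _ (fun x => _ + c)) => d.
exists ((d / Tr (b * h)) *: h) => x; rewrite qformD mulrDr TrD -scalerAr TrZ.
rewrite divfK // (qform_radical (radicalZ _ hR)).
have /eqP-> : polar g ((d / Tr (b * h)) *: h) == 0.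
  by have := radicalZ (d / Tr (b * h)) hR; rewrite inE.
by rewrite mul0r Tr0 !addr0 [in LHS]addrA [LHS]addrAC.
Qed.

(** Each [b] of the image of [polar g] is [polar g u] for [#|radical g|] values
    of [u], and has [level0 g] or [level1 g] zeros according to whether
    [qform g u = c]. *)
Lemma sum_zeros g c (H : nat -> int) :
  #|radical g|%:Z * \sum_b H (zeros g b c) =
    #|[set x | qform g x == c]|%:Z * H (level0 g)
    + ((q ^ m)%:Z - #|[set x | qform g x == c]|%:Z) * H (level1 g)
    + (#|radical g|%:Z - 1) * (q ^ m)%:Z * H (q ^ (m - 1))%N.
Proof.
rewrite (bigID (mem (polar_image g))) /= mulrDr -sum_polar_image; congr (_ + _).
  rewrite (bigID (fun u => qform g u == c)) /=; congr (_ + _).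
    rewrite (eq_bigr (fun=> H (level0 g))) => [|u /eqP uc].
      rewrite sumr_const -[LHS]mulr_natl natz; congr (Posz _ * _).
      by apply: eq_card => u; rewrite inE.
    by rewrite zeros_polar uc subrr.
  rewrite (eq_bigr (fun=> H (level1 g))) => [|u uc].
    rewrite sumr_const -[LHS]mulr_natl natz; congr (_ * _).
    rewrite -card_ext -(cardsC [set x | qform g x == c]) PoszD addrC addKr.
    by congr Posz; apply: eq_card => u; rewrite !inE.
  by rewrite zeros_polar card_level_scale // subr_eq0.
rewrite (eq_bigr (fun=> H (q ^ (m - 1))%N)) => [|b bT]; last first.
  by rewrite zeros_nonpolar.
rewrite sumr_const -[X in _ * X]mulr_natl natz mulrA; congr (_ * _).
have -> : #|[pred b | b \notin polar_image g]|%:Z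
        = (q ^ m)%:Z - #|polar_image g|%:Z.
  rewrite -card_ext -(cardsC (polar_image g)) PoszD addrC addKr.
  by congr Posz; apply: eq_card => u; rewrite [RHS]inE.
by rewrite -(card_polar_image g) mulrBr -PoszM mulrBl mul1r.
Qed.

Lemma qform_levels g s : (level0 g)%:Z - (level1 g)%:Z = Q * s ->
  (level0 g)%:Z = Q * (Dz * X) ^+ 2 + (Q - 1) * s /\
  (level1 g)%:Z = Q * (Dz * X) ^+ 2 - s.
Proof.
have q0 : Q != 0 by have := q_gt1; lia.
have := congr1 Posz (card_qform_levels g); rewrite card_ext_factor PoszD PoszM.
rewrite -subzn ?(ltnW q_gt1) // => E S.
have {}S : (level0 g)%:Z = (level1 g)%:Z + Q * s by rewrite -S; ring.
have B : (level1 g)%:Z = Q * (Dz * X) ^+ 2 - s.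
  by apply: (mulfI q0); move: E; rewrite S mulrBr !expr2; lia.
by split=> //; rewrite S B; ring.
Qed.

(** The factor [Q * (c == 0)%:R - 1] is [Q - 1] for the zero level and [-1] for
    the others. *)
Lemma card_levelE g s c : (level0 g)%:Z - (level1 g)%:Z = Q * s ->
  #|[set x | qform g x == c]|%:Z
    = Q * (Dz * X) ^+ 2 + (Q * (c == 0)%:R - 1) * s.
Proof.
case/qform_levels => E0 E1; have [->|c0] := eqVneq c 0.
  by rewrite -[LHS]/(level0 g)%:Z E0 mulr1.
by rewrite (card_level_scale g c0) -[LHS]/(level1 g)%:Z E1 mulr0 sub0r mulN1r.
Qed.

Lemma sum_zeros_nonsingular g c (H : int -> int) : g \in nonsingular ->
  let A := Q * (Dz * X) ^+ 2 + (Q * (c == 0)%:R - 1) * (e * Dz * X) in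
  \sum_b H (zeros g b c)%:Z =
    A * H (Q * (Dz * X) ^+ 2 + (Q - 1) * (e * Dz * X))
    + ((Q * Dz * X) ^+ 2 - A) * H (Q * (Dz * X) ^+ 2 - e * Dz * X).
Proof.
rewrite inE => /andP[g0 /eqP R1] A.
have SE : (level0 g)%:Z - (level1 g)%:Z = Q * (e * Dz * X).
  have [[_ ->]|[R2 _]] := qform_level_diff g0.
    by rewrite exprD_half; ring.
  by have := D_gt1; rewrite R1 in R2; nia.
have [E0 E1] := qform_levels SE.
have := sum_zeros g c (fun z => H z%:Z); rewrite R1 mul1r => ->.
by rewrite (card_levelE c SE) E0 E1 card_ext_factor subrr !mul0r addr0.
Qed.

Lemma sum_zeros_singular g c (H : int -> int) : g \in singular ->
  let A := Q * X ^+ 2 - (Q * (c == 0)%:R - 1) * (e * X) in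
  \sum_b H (zeros g b c)%:Z =
    A * H (Q * (Dz * X) ^+ 2 - (Q - 1) * (e * Dz ^+ 2 * X))
    + (Q ^+ 2 * X ^+ 2 - A) * H (Q * (Dz * X) ^+ 2 + e * Dz ^+ 2 * X)
    + (Dz ^+ 2 - 1) * (Q * X) ^+ 2 * H (Q * (Dz * X) ^+ 2).
Proof.
rewrite inE => /andP[g0 R1] A.
have [[R1' _]|[R2 SE]] := qform_level_diff g0; first by rewrite R1' in R1.
have {}SE : (level0 g)%:Z - (level1 g)%:Z = Q * (- (e * Dz ^+ 2 * X)).
  by rewrite SE !exprS expr0 exprD_half; ring.
have [E0 E1] := qform_levels SE.
have D2 : (D ^ 2)%N%:Z = Dz ^+ 2 by rewrite -rmorphXn.
have D0 : Dz ^+ 2 != 0 by rewrite expf_neq0 //; have := D_gt1; lia.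
apply: (mulfI D0); have := sum_zeros g c (fun z => H z%:Z); rewrite R2 D2 => ->.
rewrite (card_levelE c SE) E0 E1 card_ext_factor card_hyperplane.
by rewrite !mulrN opprK /A; ring.
Qed.

Lemma sum_zeros_zero_form c (H : int -> int) :
  \sum_b H (zeros 0 b c)%:Z =
    H (if c == 0 then (Q * Dz * X) ^+ 2 else 0) + N%:Z * H (Q * (Dz * X) ^+ 2).
Proof.
have q0x x : qform 0 x = 0 by rewrite /qform mul0r Tr0.
rewrite (bigD1 0) //=; congr (_ + _).
  congr H; rewrite /zeros; case: eqP => [-> | /eqP c0].
    rewrite -card_ext_factor -card_ext -cardsT; congr Posz; apply: eq_card => x.
    by rewrite !inE q0x mul0r Tr0 !addr0 eqxx.
  apply/eqP; rewrite eqz_nat cards_eq0; apply/eqP/setP=> x.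
  by rewrite !inE q0x mul0r Tr0 !add0r (negPf c0).
rewrite (eq_bigr (fun=> H (Q * (Dz * X) ^+ 2))) => [|b b0].
  by rewrite sumr_const cardC1 card_K /= -[LHS]mulr_natl natz.
congr H; rewrite -card_hyperplane; congr Posz.
have q_gt0 := ltnW q_gt1; apply/eqP; rewrite -(eqn_pmul2l q_gt0) -expnS.
rewrite subn1 prednK ?dim_ext_gt0 // -card_ext -(card_Tr_fiber (- c) b0).
apply/eqP; congr (_ * _)%N; apply: eq_card => x.
by rewrite !inE q0x add0r addr_eq0.
Qed.

Lemma card_singular : N = (#|singular| * (D + 1))%N.
Proof.
have := cardC1 (0 : K); rewrite card_K /= => <-.
rewrite mulnDr muln1 mulnC -card_nonsingular -cardsUI.
have -> : nonsingular :&: singular = set0.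
  by apply/setP=> g; rewrite !inE; case: (_ == 1%N); rewrite ?andbF.
by rewrite cards0 addn0; apply: eq_card => g; rewrite !inE -andb_orr orbN andbT.
Qed.

(** The six terms are the six kinds of parameters [(g, b)]: both zero; the
    balanced ones; and, for nonsingular and for singular [g] with [b] in the
    image of [polar g], whether [b] leads to the zero level or to another
    one. *)
Lemma sum_zeros_all c (H : int -> int) :
  let n := #|singular|%:Z in
  let z := Q * (c == 0)%:R - 1 in
  let W := Q * (Dz * X) ^+ 2 in
  let A1 := W + z * (e * Dz * X) in
  let A2 := Q * X ^+ 2 - z * (e * X) in
  \sum_g \sum_b H (zeros g b c)%:Z =
    H (if c == 0 then (Q * Dz * X) ^+ 2 else 0)
    + (n * (Dz ^+ 2 - 1) * (Q * X) ^+ 2 + N%:Z) * H W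
    + n * Dz * A1 * H (W + (Q - 1) * (e * Dz * X))
    + n * A2 * H (W - (Q - 1) * (e * Dz ^+ 2 * X))
    + n * Dz * ((Q * Dz * X) ^+ 2 - A1) * H (W - e * Dz * X)
    + n * (Q ^+ 2 * X ^+ 2 - A2) * H (W + e * Dz ^+ 2 * X).
Proof.
move=> n z W A1 A2; rewrite (bigD1 0) //= sum_zeros_zero_form.
rewrite (bigID (fun g => #|radical g| == 1%N)) /=.
rewrite (eq_bigl (mem nonsingular)) => [|g]; last by rewrite [RHS]inE.
rewrite (eq_bigr _ (fun g gS => sum_zeros_nonsingular c H gS)) sumr_const.
rewrite [X in _ + (_ + X)](eq_bigl (mem singular)); last first.
  by move=> g; rewrite [RHS]inE.
rewrite (eq_bigr _ (fun g gS => sum_zeros_singular c H gS)) sumr_const.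
rewrite -/z -/W -/A1 -/A2 card_nonsingular.
rewrite -[X in _ + (X + _)]mulr_natl -[X in _ + (_ + X)]mulr_natl.
rewrite !natz PoszM -/n.
move: (H _) (H _) (H _) (H _) (H _) (H _) => h1 h2 h3 h4 h5 h6.
move: A1 A2 n N%:Z Q Dz X => *; ring.
Qed.

(** The sum over all of [K] has the extra point [x = 0], where the function is
    [c]. *)
Lemma codeword_weight g (b : K) c :
  (hamming_weight (codeword l N a g b + const_mx c))%:Z
    = (Q * Dz * X) ^+ 2 - (zeros g b c)%:Z - (c != 0)%:R.
Proof.
pose f x := qform g x + Tr (b * x) + c.
have -> : hamming_weight (codeword l N a g b + const_mx c)
        = (\sum_(j < N) (f (a ^+ j) != 0%R))%N.
  rewrite /hamming_weight -sum1dep_card big_mkcond; apply: eq_bigr => j _.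
  by rewrite !mxE /f -TrD; case: (_ == _).
rewrite -(sum_prim card_K prim_a (fun x => nat_of_bool (f x != 0%R))).
have : (\sum_x (f x != 0%R) + zeros g b c = #|K|)%N.
  rewrite -sum1_card /zeros -sum1dep_card [X in (_ + X)%N]big_mkcond.
  rewrite -big_split /=.
  by apply: eq_bigr => x _; rewrite -/(f x); case: (_ == _).
rewrite (bigD1 0) //= {1}/f /qform expr0n addn1 !mulr0 !Tr0 !add0r.
rewrite card_ext -card_ext_factor => <-; rewrite !PoszD natz; ring.
Qed.

End Form.

(** * The weight tables *)

Section Tables.

Variables (Q D X e n : int).
Local Notation M := ((Q * D * X) ^+ 2).
Local Notation W := (Q * (D * X) ^+ 2).
Local Notation w0 := (M - W).

(** Rows of nonzero weight for the first code; here [Q = q], [D = q ^ delta] and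
    [X = q ^ (m / 2 - delta - 1)], so that the length of the code is [M - 1]. *)
Definition table1 : seq (int * int) :=
  [:: (w0, n * (M - (Q * X) ^+ 2) + M - 1);
      (w0 - e * (Q - 1) * (D * X), n * D * (W + e * (Q - 1) * (D * X)));
      (w0 + e * (Q - 1) * (D ^+ 2 * X), n * (Q * X ^+ 2 - e * (Q - 1) * X));
      (w0 + e * (D * X), n * D * (W - e * (D * X)) * (Q - 1));
      (w0 - e * (D ^+ 2 * X), n * (Q * X ^+ 2 + e * X) * (Q - 1))].

Definition table2 : seq (int * int) :=
  table1 ++
  [:: (M - 1, Q - 1);
      (w0 - 1, n * (M - (Q * X) ^+ 2) * (Q - 1) + (M - 1) * (Q - 1));
      (w0 - e * (Q - 1) * (D * X) - 1, n * D * (W - e * (D * X)) * (Q - 1));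
      (w0 + e * (Q - 1) * (D ^+ 2 * X) - 1, n * (Q * X ^+ 2 + e * X) * (Q - 1));
      (w0 + e * (D * X) - 1, n * D * (M - W + e * (D * X)) * (Q - 1));
      (w0 - e * (D ^+ 2 * X) - 1,
       n * ((Q * X) ^+ 2 - Q * X ^+ 2 - e * X) * (Q - 1))].

Hypotheses (Q_gt1 : 1 < Q) (QD : Q <= D) (X_gt0 : 0 < X) (n_gt0 : 0 < n).
Variable d : int.
Hypothesis e_d : e = 1 /\ d = w0 - D ^+ 2 * X \/
                 e = -1 /\ d = w0 - (Q - 1) * (D ^+ 2 * X).

Let D_gt1 : 1 < D. Proof. lia. Qed.
Let Y_gt0 : 0 < D * X. Proof. by rewrite mulr_gt0 //; lia. Qed.

Lemma table_dist_gt1 : 1 < d.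
Proof.
have DDX : 4 <= D ^+ 2 * X.
  have D2 : 4 <= D ^+ 2 by rewrite expr2; nia.
  by move: (D ^+ 2) D2 => D2 D2_ge; nia.
have QX2 : 2 <= Q * X by nia.
case: e_d => -[_ ->].
  have -> : w0 - D ^+ 2 * X = D ^+ 2 * X * ((Q - 1) * (Q * X) - 1) by ring.
  have : 1 <= (Q - 1) * (Q * X) - 1 by move: (Q * X) QX2 => Z Z2; nia.
  by move: (D ^+ 2 * X) ((Q - 1) * _ - 1) DDX => x y; nia.
have -> : w0 - (Q - 1) * (D ^+ 2 * X)
        = D ^+ 2 * X * ((Q - 1) * (Q * X - 1)) by ring.
have : 1 <= (Q - 1) * (Q * X - 1) by move: (Q * X) QX2 => Z Z2; nia.
by move: (D ^+ 2 * X) ((Q - 1) * (_ - 1)) DDX => x y; nia.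
Qed.

Lemma table1_ge : all (fun x => d <= x.1) table1.
Proof.
rewrite /= andbT; apply/and5P.
have YD : D ^+ 2 * X = D * (D * X) by ring.
case: e_d => -[-> ->]; rewrite YD.
  by move: (D * X) Y_gt0 => Y Y_gt0'; split; nia.
by move: (D * X) Y_gt0 => Y Y_gt0'; split; nia.
Qed.

Lemma table2_ge : all (fun x => d - 1 <= x.1) table2.
Proof.
rewrite all_cat; apply/andP; split.
  by apply: sub_all table1_ge => -[w f] /=; clear; lia.
have := table1_ge; rewrite /= !andbT => /and5P[d1 d2 d3 d4 d5].
have W0 : 0 <= W by rewrite mulr_ge0 ?sqr_ge0 //; lia.
by repeat (apply/andP; split); lia.
Qed.

(** The sizes of levels and of their complements that occur as factors of the
    frequencies, with [x = X] and [x = D * X]. *)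
Lemma frequency_factor_gt0 x s : 0 < x -> s = 1 \/ s = -1 ->
  [/\ 0 < Q * x ^+ 2 + s * (Q - 1) * x, 0 < Q * x ^+ 2 + s * x
    & 0 < Q ^+ 2 * x ^+ 2 - Q * x ^+ 2 + s * x].
Proof.
move=> x_gt0 s1.
have -> : Q * x ^+ 2 + s * (Q - 1) * x = x * (Q * x + s * (Q - 1)) by ring.
have -> : Q * x ^+ 2 + s * x = x * (Q * x + s) by ring.
have -> : Q ^+ 2 * x ^+ 2 - Q * x ^+ 2 + s * x
        = x * ((Q - 1) * (Q * x) + s) by ring.
have Qx : Q <= Q * x by rewrite ler_peMr //; lia.
have QQx : Q * x <= (Q - 1) * (Q * x) by rewrite ler_peMl //; lia.
by rewrite !pmulr_rgt0 //; case: s1 => ->; split; lia.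
Qed.

Let sign_e : e = 1 \/ e = -1.
Proof. by case: e_d => -[-> _]; [left | right]. Qed.

Let sign_Ne : - e = 1 \/ - e = -1.
Proof. by case: e_d => -[-> _]; [right | left]. Qed.

Let M_ge : 0 <= M - (Q * X) ^+ 2.
Proof.
have -> : M - (Q * X) ^+ 2 = (D ^+ 2 - 1) * (Q * X) ^+ 2 by ring.
by rewrite mulr_ge0 ?sqr_ge0 // subr_ge0 expr2; nia.
Qed.

Let M_gt0 : 0 < M.
Proof. by rewrite exprn_gt0 // !mulr_gt0 //; lia. Qed.

Lemma table1_ge0 : all (fun x => 0 <= x.2) table1.
Proof.
have [X1 X2 _] := frequency_factor_gt0 X_gt0 sign_e.
have [X1' X2' _] := frequency_factor_gt0 X_gt0 sign_Ne.
have [Y1 Y2 _] := frequency_factor_gt0 Y_gt0 sign_e.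
have [Y1' Y2' _] := frequency_factor_gt0 Y_gt0 sign_Ne.
have n0 := ltW n_gt0; have D0 : 0 <= D by lia.
have Q1 : 0 <= Q - 1 by lia.
rewrite /= andbT -!mulNr; repeat (apply/andP; split).
- by rewrite -addrA addr_ge0 ?mulr_ge0 //; lia.
- by rewrite !mulr_ge0 // ltW.
- by rewrite mulr_ge0 // ltW.
- by rewrite !mulr_ge0 // ltW.
- by rewrite !mulr_ge0 // ltW.
Qed.

Lemma table2_ge0 : all (fun x => 0 <= x.2) table2.
Proof.
have [_ X2 _] := frequency_factor_gt0 X_gt0 sign_e.
have [_ _ X3'] := frequency_factor_gt0 X_gt0 sign_Ne.
have [_ Y2' _] := frequency_factor_gt0 Y_gt0 sign_Ne.
have [_ _ Y3] := frequency_factor_gt0 Y_gt0 sign_e.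
have n0 := ltW n_gt0; have D0 : 0 <= D by lia.
have Q1 : 0 <= Q - 1 by lia.
rewrite all_cat table1_ge0 /= andbT; repeat (apply/andP; split) => //.
- by rewrite addr_ge0 ?mulr_ge0 //; lia.
- by rewrite !mulr_ge0 // -mulNr ltW.
- by rewrite !mulr_ge0 // ltW.
- rewrite !mulr_ge0 // ltW //; move: Y3; congr (0 < _ + _); ring.
- rewrite !mulr_ge0 // ltW //; move: X3'; rewrite mulNr exprMn //.
Qed.

Lemma table1_freq : has (fun x => (x.1 == d) && (0 < x.2)) table1.
Proof.
have [X1 _ _] := frequency_factor_gt0 X_gt0 sign_Ne.
have [_ X2 _] := frequency_factor_gt0 X_gt0 sign_e.
have Q1 : 0 < Q - 1 by lia.
rewrite /= -!mulNr; apply/or4P; case: e_d => -[eE ->].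
  apply: Or44; rewrite orbF; apply/orP; right; rewrite !mulr_gt0 // andbT.
  by rewrite eE; apply/eqP; ring.
by apply: Or43; rewrite mulr_gt0 // andbT eE; apply/eqP; ring.
Qed.

Lemma table2_freq : has (fun x => (x.1 == d - 1) && (0 < x.2)) table2.
Proof.
have [_ X2 _] := frequency_factor_gt0 X_gt0 sign_e.
have [_ _ X3'] := frequency_factor_gt0 X_gt0 sign_Ne.
have Q1 : 0 < Q - 1 by lia.
rewrite has_cat; apply/orP; right; case: e_d => -[eE ->] /=.
  do 5![apply/orP; right]; rewrite orbF; apply/andP; split.
    by rewrite eE; apply/eqP; ring.
  by rewrite !mulr_gt0 //; move: X3'; rewrite mulNr exprMn.
do 3![apply/orP; right]; apply/orP; left; apply/andP; split.
  by rewrite eE; apply/eqP; ring.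
by rewrite !mulr_gt0.
Qed.

End Tables.

(** * Codes from an injective linear encoder *)

Lemma hamming_dist_sub (F : finFieldType) N (c c' : 'rV[F]_N) :
  hamming_dist c c' = hamming_weight (c - c').
Proof. by apply: eq_card => j; rewrite !inE !mxE subr_eq0. Qed.

Lemma hamming_weight_eq0 (F : finFieldType) N (c : 'rV[F]_N) :
  (hamming_weight c == 0%N) = (c == 0).
Proof.
rewrite cards_eq0; apply/eqP/eqP => [/setP c0|->].
  apply/rowP => j; have := c0 j; rewrite !inE mxE => /negbFE/eqP //.
by apply/setP=> j; rewrite !inE mxE eqxx.
Qed.

(** [T] is a finite copy of the parameter space [W]: the linear structure serves
    for the dimension, and the finite one for counting. *)
Section LinearCode.

Variables (F : finFieldType) (W : vectType F) (T : finType) (u : T -> W).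
Variables (N : nat) (f : W -> 'rV[F]_N) (C : {set 'rV[F]_N}).
Variables (t : seq (int * int)) (d : nat).

Hypothesis u_bij : bijective u.
Hypothesis f_lin : linear f.
Hypothesis f_onto : forall c, reflect (exists p, c = f (u p)) (c \in C).
Hypothesis enum_f : forall G : int -> int,
  \sum_p G (hamming_weight (f (u p)))%:Z = \sum_(x <- (0, 1) :: t) x.2 * G x.1.
Hypothesis d_gt0 : (0 < d)%N.
Hypothesis t_ge_d : all (fun x => d%:Z <= x.1) t.
Hypothesis freq_d : 0 < \sum_(x <- t | x.1 == d%:Z) x.2.

(** With the indicator function of 0 for [G], [enum_f] says that exactly one
    parameter has weight 0, since all weights of [t] are at least [d]. *)
Lemma encoder_inj : injective f.
Proof.
have fB x y : f (x - y) = f x - f y.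
  by rewrite -[x - y]addrC -scaleN1r f_lin scaleN1r addrC.
suff ker0 w : f w = 0 -> w = 0.
  move=> x y fxy; apply/eqP; rewrite -subr_eq0; apply/eqP/ker0.
  by rewrite fB fxy subrr.
have f0 : f 0 = 0 by have := fB 0 0; rewrite !subrr.
move=> fw; apply/eqP; apply: contraT => w0.
have [v uK vK] := u_bij.
have := enum_f (fun z => (z == 0)%:R).
rewrite big_cons eqxx mulr1 [X in _ = _ + X]big1_seq => [|x /andP[_ xt]].
  rewrite (bigD1 (v 0)) //= (bigD1 (v w)) /=; last by rewrite (can_eq vK).
  rewrite !vK fw f0.
  have -> : hamming_weight (0 : 'rV[F]_N) = 0%N.
    by apply/eqP; rewrite hamming_weight_eq0.
  rewrite eqxx addr0 => E.
  have : 0 <= \sum_(i | (i != v 0) && (i != v w))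
          ((hamming_weight (f (u i)))%:Z == 0)%:R :> int by apply: sumr_ge0.
  by move: E; set s := \sum_(_ | _) _; lia.
by have /allP/(_ x xt) := t_ge_d; case: eqP => [-> |_ _]; [lia | rewrite mulr0].
Qed.

Lemma code_weight_distribution : has_weight_distribution C ((0, 1) :: t).
Proof.
move=> w; have [v uK vK] := u_bij.
have -> : [set c in C | (hamming_weight c)%:Z == w]
   = [set f (u p) | p in [set p | (hamming_weight (f (u p)))%:Z == w]].
  apply/setP=> c; rewrite inE; apply/andP/imsetP => [[/f_onto[p ->]] pw|[p]].
    by exists p; rewrite ?inE.
  by rewrite inE => pw ->; split=> //; apply/f_onto; exists p.
rewrite card_imset => [|x y /encoder_inj/(can_inj uK) //].
have := enum_f (fun z => (z == w)%:R).
move=> E; rewrite [RHS]big_mkcond [RHS](eq_bigr (fun x => x.2 * (x.1 == w)%:R)).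
  rewrite -E -sum1dep_card big_mkcond (big_morph Posz PoszD (erefl _)).
  by apply: eq_bigr => p _; case: eqP.
by move=> x _; case: eqP; rewrite ?mulr1 ?mulr0.
Qed.

Lemma code_params : is_code C (\dim {:W}) d.
Proof.
pose fl : {linear W -> 'rV[F]_N} :=
  HB.pack f (GRing.isLinear.Build F W 'rV[F]_N _ f f_lin).
have [v uK vK] := u_bij.
have Cimg c : (c \in C) = (c \in limg (linfun fl)).
  apply/f_onto/memv_imgP => [[p ->]|[w _ ->]].
    by exists (u p); rewrite ?memvf // lfunE.
  by exists (v w); rewrite vK lfunE.
have wt_in c : c \in C -> c != 0 -> (d <= hamming_weight c)%N.
  move=> cC c0; have := code_weight_distribution (hamming_weight c)%:Z.
  have [/hasP[x]|/hasPn no_x] :=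
    boolP (has (fun x => x.1 == (hamming_weight c)%:Z) t).
    by move/(allP t_ge_d) => /= dx /eqP xw; rewrite xw in dx.
  rewrite big_cons /= -[0 == _]/(0%N == hamming_weight c) eq_sym.
  rewrite hamming_weight_eq0 (negPf c0) big1_seq; last first.
    by move=> x /andP[xw xt]; have := no_x x xt; rewrite xw.
  move/eqP; rewrite eqz_nat cards_eq0 => /eqP/setP/(_ c).
  by rewrite !inE cC eqxx.
split.
  exists (limg (linfun fl)) => //; apply: limg_dim_eq.
  apply/eqP; rewrite -subv0; apply/subvP=> w /memv_capP[_].
  rewrite memv_ker lfunE memv0 => /eqP fw0.
  by apply/eqP/encoder_inj; rewrite -[f w]/(fl w) fw0 -[f 0]/(fl 0) linear0.
have C0 : 0 \in C by rewrite Cimg mem0v.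
split.
  have := code_weight_distribution d%:Z; rewrite big_cons /=.
  rewrite -[0 == _]/(0%N == d) eq_sym eqn0Ngt d_gt0 /= => E.
  have /card_gt0P[c] : (0 < #|[set c in C | (hamming_weight c)%:Z == d%:Z]|)%N.
    by rewrite -ltz_nat E.
  rewrite inE eqz_nat => /andP[cC /eqP cd]; exists c, 0.
  split=> //; last by rewrite hamming_dist_sub subr0.
  by rewrite -hamming_weight_eq0 cd -lt0n.
move=> c c' cC c'C cc'; rewrite hamming_dist_sub; apply: wt_in.
  by rewrite Cimg rpredB // -Cimg.
by rewrite subr_eq0.
Qed.

End LinearCode.

Lemma all_has_sum_gt0 (t : seq (int * int)) (d : int) :
    all (fun x => 0 <= x.2) t -> has (fun x => (x.1 == d) && (0 < x.2)) t ->
  0 < \sum_(x <- t | x.1 == d) x.2.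
Proof.
elim: t => //= x t IHt /andP[x0 t0] /orP[/andP[xd xgt] | td]; rewrite big_cons.
  by rewrite xd ltr_wpDr // big_seq_cond sumr_ge0 // => y /andP[/(allP t0)].
by case: ifP => _; rewrite ?ltr_wpDl ?IHt.
Qed.

Lemma dimv_prod (F : fieldType) (U V : vectType F) :
  \dim {: (U * V)%type} = (\dim {:U} + \dim {:V})%N.
Proof. by rewrite !dimvf. Qed.

Lemma dimv_regular (F : fieldType) : \dim {: F^o} = 1%N.
Proof. by rewrite dimvf. Qed.

(** * The codes as images of linear encoders *)

Section Encoders.

Variables (F : finFieldType) (L : fieldExtType F) (l N : nat) (a : L).

Lemma codeword_linear :
  linear (fun p : L * L => codeword l N a p.1 p.2).
Proof.
move=> c p p'; apply/rowP=> j; rewrite !mxE /=.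
have TrDL (x y : L) : Tr (x + y) = Tr x + Tr y.
  exact: (TrD (x : finvect_type L) y).
have TrZL (x : L) : Tr (c *: x) = c * Tr x.
  exact: (TrZ c (x : finvect_type L)).
by rewrite -TrZL -TrDL; congr Tr; rewrite !mulrDl -!scalerAl scalerDr addrACA.
Qed.

Lemma codeword_const_linear :
  linear (fun p : L * L * F^o => codeword l N a p.1.1 p.1.2 + const_mx p.2).
Proof.
move=> c p p'; rewrite (codeword_linear c p.1 p'.1) scalerDr addrACA.
by congr (_ + _); apply/rowP=> j; rewrite !mxE.
Qed.

Lemma mem_code1 c :
  reflect (exists p : finvect_type L * finvect_type L,
             c = codeword l N a p.1 p.2)
    (c \in code1 l N a).
Proof.
apply: (iffP imset2P) => [[g b _ _ ->]|[p ->]]; first by exists (g, b).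
by exists p.1 p.2.
Qed.

Lemma mem_code2 c :
  reflect (exists p : finvect_type L * finvect_type L * F,
             c = codeword l N a p.1.1 p.1.2 + const_mx p.2)
    (c \in code2 l N a).
Proof.
apply: (iffP imset2P) => [[p b _ _ ->]|[p ->]]; first by exists (p, b).
by exists p.1 p.2.
Qed.

End Encoders.

(** * The weight enumerators of the two codes *)

Section Enumerators.

Variables (F : finFieldType) (L : fieldExtType F) (l : nat).
Local Notation K := (finvect_type L).
Local Notation codeword := (@codeword F L).
Local Notation q := #|F|.
Local Notation m := (\dim {:L}).
Local Notation delta := (gcdn m l).

Hypotheses (l2_lt_m : (l.*2 < m)%N) (l_gt0 : (0 < l)%N).
Hypothesis cof_even : ~~ odd (m %/ delta).
Variables (a : K) (N : nat).
Hypothesis card_K : #|K| = N.+1.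
Hypothesis prim_a : N.-primitive_root a.

Local Notation X := (q ^ (m./2 - delta - 1))%N%:Z.
Local Notation Q := (q%:Z).
Local Notation D := ((q ^ delta)%N%:Z).
Local Notation e := ((-1) ^+ (m %/ delta)./2 : int).
Local Notation n := (#|singular L l|%:Z).

Let NE : N%:Z = (Q * D * X) ^+ 2 - 1.
Proof.
by rewrite -(card_ext_factor l2_lt_m l_gt0 cof_even) -card_ext card_K; lia.
Qed.

Let const_mx0 : const_mx 0 = 0 :> 'rV[F]_N.
Proof. by apply/rowP=> j; rewrite !mxE. Qed.

Lemma enumerator1 (G : int -> int) :
  \sum_(p : K * K) G (hamming_weight (codeword l N a p.1 p.2))%:Z =
  \sum_(x <- (0, 1) :: table1 Q D X e n) x.2 * G x.1.
Proof.
have -> : \sum_(p : K * K) G (hamming_weight (codeword l N a p.1 p.2))%:Z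
   = \sum_(g : K) \sum_(b : K) G ((Q * D * X) ^+ 2 - (zeros l g b 0)%:Z).
  rewrite pair_bigA /=; apply: eq_bigr => p _; congr G.
  have := codeword_weight l2_lt_m l_gt0 cof_even card_K prim_a p.1 p.2 0.
  by rewrite eqxx subr0 => <-; rewrite const_mx0 addr0.
rewrite (sum_zeros_all l2_lt_m l_gt0 cof_even card_K prim_a 0
   (fun z => G ((Q * D * X) ^+ 2 - z))) eqxx NE.
rewrite /table1 !big_cons big_nil /=.
move: n D X Q e => n D X Q e.
set w0 := _ - Q * _.
rewrite subrr.
have -> : (Q * D * X) ^+ 2 - (Q * (D * X) ^+ 2 + (Q - 1) * (e * D * X))
        = w0 - e * (Q - 1) * (D * X) by rewrite /w0; ring.
have -> : (Q * D * X) ^+ 2 - (Q * (D * X) ^+ 2 - (Q - 1) * (e * D ^+ 2 * X))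
        = w0 + e * (Q - 1) * (D ^+ 2 * X) by rewrite /w0; ring.
have -> : (Q * D * X) ^+ 2 - (Q * (D * X) ^+ 2 - e * D * X)
        = w0 + e * (D * X) by rewrite /w0; ring.
have -> : (Q * D * X) ^+ 2 - (Q * (D * X) ^+ 2 + e * D ^+ 2 * X)
        = w0 - e * (D ^+ 2 * X) by rewrite /w0; ring.
move: (G _) (G _) (G _) (G _) (G _) (G _) => *; ring.
Qed.

Lemma enumerator2 (G : int -> int) :
  \sum_(p : K * K * F)
     G (hamming_weight (codeword l N a p.1.1 p.1.2 + const_mx p.2))%:Z =
  \sum_(x <- (0, 1) :: table2 Q D X e n) x.2 * G x.1.
Proof.
transitivity (\sum_(c : F) \sum_(g : K) \sum_(b : K)
                G ((Q * D * X) ^+ 2 - (zeros l g b c)%:Z - (c != 0)%:R)).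
  under [RHS]eq_bigr do rewrite pair_bigA /=.
  rewrite exchange_big pair_bigA /=; apply: eq_bigr => p _; congr G.
  exact: codeword_weight.
(* The parameters with c = 0 give the first code, and each c != 0 contributes
   the same sum T. *)
rewrite (bigD1 0) //= /table2 -cat_cons big_cat /= -enumerator1; congr (_ + _).
  rewrite pair_bigA /=; apply: eq_bigr => p _; congr G.
  have := codeword_weight l2_lt_m l_gt0 cof_even card_K prim_a p.1 p.2 0.
  by rewrite eqxx => <-; rewrite const_mx0 addr0.
pose M : int := (Q * D * X) ^+ 2; pose W : int := Q * (D * X) ^+ 2.
pose w0 := M - W.
pose T : int := G (M - 1) + (n * (M - (Q * X) ^+ 2) + M - 1) * G (w0 - 1)
  + n * D * (W - e * (D * X)) * G (w0 - e * (Q - 1) * (D * X) - 1)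
  + n * (Q * X ^+ 2 + e * X) * G (w0 + e * (Q - 1) * (D ^+ 2 * X) - 1)
  + n * D * (M - W + e * (D * X)) * G (w0 + e * (D * X) - 1)
  + n * ((Q * X) ^+ 2 - Q * X ^+ 2 - e * X) * G (w0 - e * (D ^+ 2 * X) - 1).
rewrite (eq_bigr (fun=> T)) => [|c c0].
  rewrite sumr_const cardC1 -[LHS]mulr_natl natz.
  have -> : (q.-1)%:Z = Q - 1 by rewrite -subn1 -subzn // ltnW ?finNzRing_gt1.
  rewrite !big_cons big_nil /= /T /w0 /M /W.
  move: n D X Q e => n D X Q e.
  move: (G _) (G _) (G _) (G _) (G _) (G _) => *; ring.
rewrite (sum_zeros_all l2_lt_m l_gt0 cof_even card_K prim_a c
   (fun z => G ((Q * D * X) ^+ 2 - z - (c != 0)%:R))) (negPf c0) NE.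
rewrite -/M -/W /T /w0 subr0 mulr0 sub0r !mulN1r opprK -[true%:R]/(1 : int).
move: @M @W @w0 @T; move: n D X Q e => n D X Q e M W w0 T.
have -> : M - (W + (Q - 1) * (e * D * X))
        = M - W - e * (Q - 1) * (D * X) by ring.
have -> : M - (W - (Q - 1) * (e * D ^+ 2 * X))
        = M - W + e * (Q - 1) * (D ^+ 2 * X) by ring.
have -> : M - (W - e * D * X) = M - W + e * (D * X) by ring.
have -> : M - (W + e * D ^+ 2 * X) = M - W - e * (D ^+ 2 * X) by ring.
move: (G _) (G _) (G _) (G _) (G _) (G _) => *; rewrite /M /W; ring.
Qed.

End Enumerators.

(** * Weight distributions and parameters of the two codes *)

Lemma exprn_half_split (Q : int) m h delta : m = h.*2 -> (delta < h)%N ->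
  let D := Q ^+ delta in let X := Q ^+ (h - delta - 1) in
  [/\ Q ^+ m = (Q * D * X) ^+ 2, Q ^+ (m - 1) = Q * (D * X) ^+ 2
     & Q ^+ (m - 2 * delta) = (Q * X) ^+ 2] /\
  [/\ Q ^+ (m - 1 - 2 * delta) = Q * X ^+ 2, Q ^+ (h - 1) = D * X
     & Q ^+ (h + delta - 1) = D ^+ 2 * X].
Proof.
move=> -> lt_dh; rewrite /= -!exprD -!exprS -!exprD -!exprM -!exprD -!exprS.
by do 2!split; congr (_ ^+ _); lia.
Qed.

Theorem theorem4p4 (F : finFieldType) (L : fieldExtType F) (q m l : nat)
    (hq : #|F| = q) (hm : \dim {:L} = m) (hl0 : (0 < l)%N)
    (hl : (l.*2 < m)%N) (hml : ~~ odd (m %/ gcdn m l))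
    (a : L) (ha : (q ^ m - 1)%N.-primitive_root a) :
  let N := (q ^ m - 1)%N in
  let delta := gcdn m l in
  let ml := (m %/ delta)%N in
  let d' := (if odd ml./2 then (q - 1) * q ^ (m./2 + delta - 1)
             else q ^ (m./2 + delta - 1))%N in
  let d := (q ^ (m - 1) * (q - 1) - d')%N in
  let n : int := ((q ^ m - 1) %/ (q ^ delta + 1))%N%:Z in
  let eps : int := (-1) ^+ ml./2 in
  let Q : int := q%:Z in
  let w0 : int := Q ^+ m - Q ^+ (m - 1) in
  let weights1 : seq (int * int) :=
    [:: (0, 1);
        (w0,
         n * (Q ^+ m - Q ^+ (m - 2 * delta)) + Q ^+ m - 1);
        (w0 - eps * (Q - 1) * Q ^+ (m./2 - 1),
         n * Q ^+ delta
           * (Q ^+ (m - 1) + eps * (Q - 1) * Q ^+ (m./2 - 1)));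
        (w0 + eps * (Q - 1) * Q ^+ (m./2 + delta - 1),
         n * (Q ^+ (m - 1 - 2 * delta)
              - eps * (Q - 1) * Q ^+ (m./2 - delta - 1)));
        (w0 + eps * Q ^+ (m./2 - 1),
         n * Q ^+ delta * (Q ^+ (m - 1) - eps * Q ^+ (m./2 - 1)) * (Q - 1));
        (w0 - eps * Q ^+ (m./2 + delta - 1),
         n * (Q ^+ (m - 1 - 2 * delta) + eps * Q ^+ (m./2 - delta - 1))
           * (Q - 1))] in
  let weights2 : seq (int * int) :=
    weights1 ++
    [:: (Q ^+ m - 1, Q - 1);
        (w0 - 1,
         n * (Q ^+ m - Q ^+ (m - 2 * delta)) * (Q - 1)
           + (Q ^+ m - 1) * (Q - 1));
        (w0 - eps * (Q - 1) * Q ^+ (m./2 - 1) - 1,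
         n * Q ^+ delta * (Q ^+ (m - 1) - eps * Q ^+ (m./2 - 1)) * (Q - 1));
        (w0 + eps * (Q - 1) * Q ^+ (m./2 + delta - 1) - 1,
         n * (Q ^+ (m - 1 - 2 * delta) + eps * Q ^+ (m./2 - delta - 1))
           * (Q - 1));
        (w0 + eps * Q ^+ (m./2 - 1) - 1,
         n * Q ^+ delta * (Q ^+ m - Q ^+ (m - 1) + eps * Q ^+ (m./2 - 1))
           * (Q - 1));
        (w0 - eps * Q ^+ (m./2 + delta - 1) - 1,
         n * (Q ^+ (m - 2 * delta) - Q ^+ (m - 1 - 2 * delta)
              - eps * Q ^+ (m./2 - delta - 1)) * (Q - 1))] in
  [/\ is_code (code1 l N a) (2 * m) d,
      is_code (code2 l N a) (2 * m + 1) (d - 1),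
      has_weight_distribution (code1 l N a) weights1 &
      has_weight_distribution (code2 l N a) weights2].
Proof.
move: hq hm hl hml ha => <- <- {q m} l2_lt_m cof_even prim_a.
move=> N delta ml d' d n eps Q w0.
pose K := finvect_type L.
have q_gt1 : (1 < #|F|)%N := finNzRing_gt1 F.
have card_K : #|K| = N.+1.
  by rewrite card_ext /N subn1 prednK // expn_gt0 ltnW.
have [hE [lt_dh mE]] := half_dim l2_lt_m hl0 cof_even.
have n_eq : n = #|singular L l|%:Z.
  have NE := card_singular l2_lt_m hl0 cof_even card_K prim_a.
  by rewrite /n -/N {1}NE mulnK // addn1.
have n_gt0 : 0 < n.
  have := prim_order_gt0 prim_a; rewrite n_eq -/N.
  rewrite (card_singular l2_lt_m hl0 cof_even card_K prim_a) muln_gt0.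
  by case/andP.
have delta_gt0 : (0 < delta)%N by rewrite gcdn_gt0 hl0 orbT.
have [[P0 P1 P4] [P5 P2 P3]] := exprn_half_split Q mE lt_dh.
set D := Q ^+ delta in P0 P1 P2 P3 P4 P5.
set X := Q ^+ (_ - _ - 1) in P0 P1 P2 P3 P4 P5.
have DE : (#|F| ^ delta)%N%:Z = D by rewrite /D -rmorphXn.
have XE : (#|F| ^ ((\dim {:L})./2 - delta - 1))%N%:Z = X.
  by rewrite /X -rmorphXn.
have Q_gt1 : 1 < Q by rewrite ltz_nat.
have X_gt0 : 0 < X by rewrite exprn_gt0 // (lt_trans _ Q_gt1).
have QD : Q <= D.
  by rewrite /D -(prednK delta_gt0) exprS ler_peMr // exprn_ege1 // ltW.
have w0E : (#|F| ^ (\dim {:L} - 1) * (#|F| - 1))%N%:Z = w0.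
  rewrite /w0 P0 P1 PoszM -subzn ?(ltnW q_gt1) // [Posz (_ ^ _)]rmorphXn /= P1.
  by ring.
have e_d' : eps = 1 /\ w0 - d'%:Z = w0 - D ^+ 2 * X \/
            eps = -1 /\ w0 - d'%:Z = w0 - (Q - 1) * (D ^+ 2 * X).
  rewrite /eps /d' -signr_odd; case: (odd _); [right | left]; split=> //.
    by rewrite PoszM -subzn ?(ltnW q_gt1) // [Posz (_ ^ _)]rmorphXn /= P3.
  by rewrite rmorphXn /= P3.
have w0_def : w0 = (Q * D * X) ^+ 2 - Q * (D * X) ^+ 2 by rewrite /w0 P0 P1.
move: (e_d'); rewrite w0_def => e_d.
have d_gt1' : 1 < w0 - d'%:Z.
  by rewrite w0_def; exact (table_dist_gt1 Q_gt1 QD X_gt0 n_gt0 e_d).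
have dE : d%:Z = w0 - d'%:Z.
  have d'_le : (d' <= #|F| ^ (\dim {:L} - 1) * (#|F| - 1))%N.
    by rewrite -lez_nat w0E; lia.
  by rewrite /d -subzn // w0E.
have d_gt1 : (1 < d)%N by rewrite -ltz_nat dE.
have dB : (d - 1)%N%:Z = w0 - d'%:Z - 1 by rewrite -subzn 1?ltnW // dE.
rewrite w0_def in dE dB.
have := enumerator1 l2_lt_m hl0 cof_even card_K prim_a.
have := enumerator2 l2_lt_m hl0 cof_even card_K prim_a.
rewrite DE XE -n_eq => enum2 enum1.
have [t1_params t1_dist] :
    is_code (code1 l N a) (2 * \dim {:L}) d /\
    has_weight_distribution (code1 l N a) ((0, 1) :: table1 Q D X eps n).
  have u_bij : bijective (fun p : K * K => p : (L * L)%type) by exists id.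
  have lin := @codeword_linear F L l N a.
  have onto := @mem_code1 F L l N a.
  have ge_d : all (fun x => d%:Z <= x.1) (table1 Q D X eps n).
    by rewrite dE; apply: table1_ge.
  have freq : 0 < \sum_(x <- table1 Q D X eps n | x.1 == d%:Z) x.2.
    rewrite dE; apply: all_has_sum_gt0.
      exact: (table1_ge0 Q_gt1 QD X_gt0 n_gt0 e_d).
    exact: (table1_freq Q_gt1 QD X_gt0 n_gt0 e_d).
  split; last first.
    exact: (code_weight_distribution u_bij lin onto enum1 (ltnW d_gt1) ge_d).
  have := code_params u_bij lin onto enum1 (ltnW d_gt1) ge_d freq.
  by rewrite dimv_prod addnn mul2n.
have [t2_params t2_dist] :
    is_code (code2 l N a) (2 * \dim {:L} + 1) (d - 1) /\
    has_weight_distribution (code2 l N a) ((0, 1) :: table2 Q D X eps n).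
  have u_bij : bijective (fun p : K * K * F => p : (L * L * F^o)%type).
    by exists id.
  have lin := @codeword_const_linear F L l N a.
  have onto := @mem_code2 F L l N a.
  have ge_d : all (fun x => (d - 1)%N%:Z <= x.1) (table2 Q D X eps n).
    by rewrite dB; apply: table2_ge.
  have d1_gt0 : (0 < d - 1)%N by rewrite subn_gt0.
  have freq : 0 < \sum_(x <- table2 Q D X eps n | x.1 == (d - 1)%N%:Z) x.2.
    rewrite dB; apply: all_has_sum_gt0.
      exact: (table2_ge0 Q_gt1 QD X_gt0 n_gt0 e_d).
    exact: (table2_freq Q_gt1 QD X_gt0 n_gt0 e_d).
  split; last first.
    exact: (code_weight_distribution u_bij lin onto enum2 d1_gt0 ge_d).
  have := code_params u_bij lin onto enum2 d1_gt0 ge_d freq.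
  by rewrite !dimv_prod dimv_regular addnn mul2n.
rewrite /w0 P0 P1 P2 P3 P4 P5.
by split.
Qed.
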